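(* Let $L,T>0$, $\alpha\in\mathbb R$, and let $A:\mathbb R\to\mathfrak{sl}(2,\mathbb R)$ be (measurable) bounded, $L$-periodic and of mean zero, $\int_0^L A(s)\,ds=0$. For $N\in\mathbb N$ put $\rho=\rho_N=T/(NL)$, $C_\rho(t)=\rho^{-\alpha}A(t/\rho)$, and let $Z_\rho$ solve $$Z_\rho'(t)=C_\rho(t)Z_\rho(t),\qquad Z_\rho(0)=I .$$ Set $$\Omega_2[A]=\frac12\int_0^L\int_0^{s_1}[A(s_1),A(s_2)]\,ds_2\,ds_1 .$$ Then, as $N\to\infty$: (i) if $\alpha<1/2$, then $Z_{\rho_N}(T)\to I$; (ii) if $\alpha=1/2$, then $$Z_{\rho_N}(T)\longrightarrow \exp\!\left(\frac TL\,\Omega_2[A]\right).$$ (iii) The matrix $\Omega_2[A]$ being a trace-free $2\times2$ matrix, the limiting return $\exp\!\left(\frac TL\Omega_2[A]\right)$ is hyperbolic if and only if $\det\Omega_2[A]<0$.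
   Context: $\mathfrak{sl}(2,\mathbb R)$ is the space of real trace-free $2\times 2$ matrices and $[X,Y]=XY-YX$. A matrix in $SL(2,\mathbb R)$ is called hyperbolic if it has two real eigenvalues, one of modulus larger than one and one of modulus smaller than one. *)

(* Defs.v *)
From HB Require Import structures.
From mathcomp Require Import all_boot all_order all_algebra.
From mathcomp Require Import all_classical all_reals all_analysis.

Set Implicit Arguments.
Unset Strict Implicit.
Unset Printing Implicit Defensive.

Import Order.TTheory GRing.Theory Num.Theory.
Import numFieldNormedType.Exports.

Local Open Scope classical_set_scope.
Local Open Scope ring_scope.

(* [measurable_fun] on [R] itself means Borel measurable.  Here measurability,
   integrals and "almost everywhere" refer to the Lebesgue sigma-algebra: the
   (complete) Caratheodory sigma-algebra carrying
   [completed_lebesgue_measure]. *)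
Definition lebesgueType (R : realType) :=
  caratheodory_type (@wlength R idfun)^*%mu.

Definition lebesgue_measurable_fun (R : realType) (f : R -> R) : Prop :=
  measurable_fun [set: lebesgueType R] (f : lebesgueType R -> R).

Definition mx_measurable (R : realType) (F : R -> 'M[R]_2) : Prop :=
  forall i j, lebesgue_measurable_fun (fun t => F t i j).

Definition mx_int (R : realType) (a b : R) (F : R -> 'M[R]_2) : 'M[R]_2 :=
  \matrix_(i, j) \int[@completed_lebesgue_measure R]_(s in `[a, b]) F s i j.

Definition sl2 (R : realType) : set 'M[R]_2 := [set X | \tr X = 0].

Definition mx_bracket (R : realType) (X Y : 'M[R]_2) : 'M[R]_2 :=
  X *m Y - Y *m X.

Definition mx_exp (R : realType) (X : 'M[R]_2) : 'M[R]_2 :=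
  lim (series (fun k : nat => k`!%:R^-1 *: X ^+ k) @ \oo).

Definition hyperbolic (R : realType) (M : 'M[R]_2) : Prop :=
  \det M = 1 /\
  exists l m : R,
    [/\ eigenvalue M l, eigenvalue M m, 1 < `|l| & `|m| < 1].

Definition absolutely_continuous (R : realType) (V : normedModType R)
    (a b : R) (f : R -> V) : Prop :=
  forall e : R, 0 < e -> exists2 d : R, 0 < d &
    forall (n : nat) (u v : 'I_n -> R),
      (forall k, a <= u k /\ u k <= v k /\ v k <= b) ->
      trivIset [set: 'I_n] (fun k => `]u k, v k[%classic) ->
      \sum_(k < n) (v k - u k) < d ->
      \sum_(k < n) `|f (v k) - f (u k)| < e.

(* Since the coefficient [C] is only measurable, [Z' = C Z] is understood in
   the sense of Caratheodory. *)
Definition fundamental_solution (R : realType) (T : R)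
    (C Z : R -> 'M[R]_2) : Prop :=
  [/\ absolutely_continuous 0 T Z,
      Z 0 = 1%:M &
      {ae @completed_lebesgue_measure R, forall t : R, 0 < t < T ->
        is_derive t 1 Z (C t *m Z t)}].

Definition rho (R : realType) (L T : R) (N : nat) : R := T / (N%:R * L).

Definition C_rho (R : realType) (alpha : R) (A : R -> 'M[R]_2) (r : R)
    (t : R) : 'M[R]_2 :=
  (r `^ (- alpha)) *: A (t / r).

Definition Omega2 (R : realType) (L : R) (A : R -> 'M[R]_2) : 'M[R]_2 :=
  2^-1 *: mx_int 0 L (fun s1 =>
            mx_int 0 s1 (fun s2 => mx_bracket (A s1) (A s2))).

(* Main.v *)
(** The matrix [Z_rho(T)] is a product of [N] one-period propagators.  After
    rescaling time to [[0, L]], one period is governed by [Y' = e A Y] with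
    [e = rho^(1 - alpha)].  With [B(s)] the integral of [A] on [[0, s]], three
    applications of the mean value inequality for absolutely continuous
    functions give [Y(L) = (1 + e B(L) + e^2 D(L)) Y(0) + O(e^3)], where [D' = A B].
    Here [B(L) = 0], and [B^2 = int (A B + B A)] vanishes at [L], so that
    [D(L) = Omega2].  Iterating [N ~ T / (rho L)] times, the corrections sum to
    [O(rho^(1 - 2 alpha))] if [alpha < 1/2], while for [alpha = 1/2] one has
    [e^2 = rho], and the product is an Euler scheme for the flow of
    [(T/L) Omega2].  Since [X^2 = - det X] for a trace-free [X], the exponential
    is [c + s X] with [c^2 + s^2 det X = 1], whence the last claim. *)

Require Import Defs.
From HB Require Import structures.
From mathcomp Require Import all_boot all_order all_algebra.
From mathcomp Require Import all_classical all_reals all_analysis.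
From mathcomp Require Import measurable_realfun ring lra.

Set Implicit Arguments.
Unset Strict Implicit.
Unset Printing Implicit Defensive.

Import Order.TTheory GRing.Theory Num.Theory.
Import numFieldNormedType.Exports.

Local Open Scope classical_set_scope.
Local Open Scope ring_scope.

(** * Absolutely continuous functions *)

(** Since [A] is only bounded and Lebesgue measurable, a solution satisfies its equation only almost
    everywhere, so estimates are drawn from derivative bounds off null sets. With derivative bound
    [0] the same comparison identifies two functions, and this replaces integration by parts in the
    identities for [B^2] and for the brackets. Rescaling a period multiplies the amplitude
    [rho^(-alpha)] by [rho]; hence the exponent [p = 1 - alpha] used below. Both regimes come from
    one comparison of an approximate product with a flow: for [alpha = 1/2] it is the flow of
    [(T/L) Omega2], with local error [O(e^3)]; for [alpha < 1/2] it is the constant flow of [X = 0],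
    the term [e^2 Omega2] being counted as error too. The total [N e^3 = (N e^2) e] tends to zero
    either way, because [N e^2 = (T/L) rho^(1 - 2 alpha)] stays bounded. *)

(** Both notions amount to vanishing outer measure, so exceptional sets can be handled with Borel
    null sets only. *)
Lemma completed_negligible (R : realType) (N : set R) :
  (@completed_lebesgue_measure R).-negligible N <->
  (@lebesgue_measure R).-negligible N.
Proof.
rewrite negligible_outer_measure; split=> [[A [mA A0 NA]]|N0].
  by apply/eqP; rewrite eq_le outer_measure_ge0 andbT -A0 le_outer_measure.
have [A [mA A0 NA]] := (negligible_outer_measure N).2 N0.
by exists A; split => //; exact: sub_caratheodory.
Qed.

Lemma is_derive_increment (R : realType) (V : normedModType R) (f : R -> V)
    (x : R) (df : V) (e : R) : 0 < e -> is_derive x 1 f df ->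
  exists2 d : R, 0 < d &
    forall y, `|y - x| < d -> `|f y - f x| <= (`|df| + e) * `|y - x|.
Proof.
move=> e0 [dfx fdf].
have := dfx; rewrite /derivable => /cvgrPdist_le /(_ e e0).
rewrite -/(derive f x 1) fdf => -[d /= d0 H].
exists d => // y yx; have [->|xy] := eqVneq y x.
  by rewrite !subrr !normr0 mulr0.
have h0 : y - x != 0 by rewrite subr_eq0.
have := H (y - x); rewrite /= sub0r normrN => /(_ yx h0).
rewrite [(y - x) *: 1]mulr1 subrK => H1.
have -> : f y - f x = (y - x) *: ((y - x)^-1 *: (f y - f x)).
  by rewrite scalerA mulfV// scale1r.
rewrite normrZ mulrC ler_pM2r ?normr_gt0//.
rewrite -[X in `|X|](subrK df) (le_trans (ler_normD _ _))//.
by rewrite addrC lerD2l distrC.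
Qed.

Lemma trivIset_seq_itv (R : realType) (n : nat) (u v : nat -> R) :
  (forall i j, (i < j < n)%N -> v i <= u j) ->
  trivIset [set: 'I_n] (fun k => `]u k, v k[%classic).
Proof.
move=> vu i j _ _ [x []] /=; rewrite !in_itv/= => /andP[xui xvi] /andP[xuj xvj].
apply/val_inj => /=; apply/eqP/negPn/negP; rewrite neq_ltn => /orP[] ij.
- have := vu i j; rewrite ij ltn_ord => /(_ isT) h.
  by have := lt_trans (le_lt_trans h xuj) xvi; rewrite ltxx.
- have := vu j i; rewrite ij ltn_ord => /(_ isT) h.
  by have := lt_trans (le_lt_trans h xui) xvj; rewrite ltxx.
Qed.

Lemma sum_itv_length_le (R : realType) (U : set R) (n : nat) (u v : 'I_n -> R) :
  measurable U -> (forall k, u k <= v k) ->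
  trivIset [set: 'I_n] (fun k => `]u k, v k[%classic) ->
  (forall k, `]u k, v k[ `<=` U) ->
  ((\sum_(k < n) (v k - u k))%:E <= lebesgue_measure U)%E.
Proof.
move=> mU uv tr sU; rewrite -sumEFin.
have -> : (\sum_(k < n) (v k - u k)%:E =
           \sum_(k < n) lebesgue_measure `]u k, v k[%classic)%E.
  apply: eq_bigr => k _; rewrite lebesgue_measure_itv/= lte_fin.
  have := uv k; rewrite le_eqVlt => /orP[/eqP->|->]; last by rewrite EFinB.
  by rewrite ltxx subrr.
have -> : (\sum_(k < n) lebesgue_measure `]u k, v k[%classic =
           lebesgue_measure (\big[setU/set0]_(k < n) `]u k, v k[%classic))%E.
  by rewrite (measure_bigsetU_ord _ xpredT)// => k; exact: measurable_itv.
apply: le_measure; rewrite ?inE//.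
  by apply: bigsetU_measurable => i _; exact: measurable_itv.
by elim/big_ind : _ => // A B AU BU x [/AU|/BU].
Qed.

(* Cousin's covering argument: points of differentiability control short
   increments by the derivative, while the increments tagged by exceptional
   points live in an open set of small measure. *)
Lemma absolutely_continuous_increment (R : realType) (V : normedModType R)
    (f : R -> V) (a b M : R) (N : set R) : 0 <= M -> a <= b ->
  absolutely_continuous a b f ->
  (@lebesgue_measure R).-negligible N ->
  (forall x, a < x < b -> ~ N x ->
     exists2 df, is_derive x 1 f df & `|df| <= M) ->
  `|f b - f a| <= M * (b - a).
Proof.
move=> M0 ab acf N0 fM; apply/ler_addgt0Pr => e e0.
(* The [+ 1] keeps the denominator positive when [a = b]; the slack [e' * (b - a)] is at most
   [e / 2]. *)
pose e' := e / 2 / (b - a + 1).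
have ba1 : 0 < b - a + 1 by rewrite ltr_wpDl// subr_ge0.
have e'0 : 0 < e' by rewrite !divr_gt0.
have [d d0 H] := acf (e / 2) (divr_gt0 e0 (ltr0Sn R 1)).
(* Derivatives are given only strictly inside, so the endpoints join the exceptional set. *)
have nN : (@lebesgue_measure R).-negligible (N `|` [set a] `|` [set b]).
  apply: negligibleU; first apply: negligibleU => //.
    by exists [set a]; split => //; exact: lebesgue_measure_set1.
  by exists [set b]; split => //; exact: lebesgue_measure_set1.
have [U [oU NU muU]] :=
  outer_measure_open_le (N `|` [set a] `|` [set b]) (divr_gt0 d0 (ltr0Sn R 1)).
rewrite (negligible_outer_measure _).1// add0e in muU.
(* The bound holds up to [x] apart from increments over finitely many ordered intervals inside [U].
   These increments are kept as they are; absolute continuity bounds their sum once, at the end. *)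
pose good x := exists n (u v : nat -> R),
  [/\ forall k, (k < n)%N -> [/\ a <= u k, u k <= v k, v k <= x &
        `]u k, v k[ `<=` U],
      forall i j, (i < j < n)%N -> v i <= u j &
      `|f x - f a| <= (M + e') * (x - a) +
                      \sum_(k < n) `|f (v k) - f (u k)|].
(* Every [x] serves as tag for the short intervals around it: goodness passes across [x] from [u] to
   [v]. *)
have good_step x : a <= x <= b -> exists2 r, 0 < r & forall u v,
    x - r < u -> v < x + r -> a <= u -> u <= x -> x <= v -> v <= b ->
    good u -> good v.
  move=> /andP[ax xb].
  have [Nx|Nx] := pselect ((N `|` [set a] `|` [set b]) x).
    have [r /= r0 Hr] := open_subball oU (NU _ Nx).
    have xU y : x - r / 2 < y < x + r / 2 -> U y.
      move=> /andP[y1 y2]; apply: (Hr (r / 2)) => //=.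
      - by rewrite sub0r normrN gtr0_norm ?divr_gt0// ltr_pdivrMr// ltr_pMr// ltr1n.
      - by rewrite divr_gt0.
      - by rewrite /ball/= ltr_distlC y1 y2.
    exists (r / 2); first by rewrite divr_gt0.
    move=> u v xru vxr au ux xv vb [n [us [vs [H1 H2 H3]]]].
    (* Exceptional tag: the whole of []u, v[] lies in [U] and is appended to the list. *)
    exists n.+1, (fun k => if k == n then u else us k),
      (fun k => if k == n then v else vs k); split.
    - move=> k; rewrite ltnS leq_eqVlt; have [_ _|_ /= kn] := eqVneq k n.
        split => //; first exact: le_trans ux xv.
        move=> y /=; rewrite in_itv/= => /andP[uy yv]; apply: xU.
        by rewrite (lt_trans xru uy) (lt_trans yv vxr).
      have [h1 h2 h3 h4] := H1 _ kn; split => //.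
      by rewrite (le_trans h3)// (le_trans ux).
    - move=> i j /andP[ij]; rewrite ltnS leq_eqVlt => /orP[/eqP jn|jn].
        by rewrite jn eqxx (ltn_eqF (leq_trans ij _)) ?jn//;
          have [] := H1 i (leq_trans ij (eq_leq jn)).
      have ilt := ltn_trans ij jn.
      by rewrite !ltn_eqF// H2// ij.
    - rewrite big_ord_recr/= eqxx.
      under eq_bigr => k _ do rewrite (ltn_eqF (ltn_ord k)).
      have -> : f v - f a = (f u - f a) + (f v - f u).
        by rewrite [RHS]addrC addrA subrK.
      rewrite (le_trans (ler_normD _ _))// [leRHS]addrA lerD2r.
      rewrite (le_trans H3)// lerD2r.
      by rewrite ler_wpM2l ?addr_ge0 ?(ltW e'0)// lerD2r (le_trans ux).
  have axb : a < x < b.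
    by apply/andP; split; rewrite lt_neqAle ?ax ?xb andbT; apply/eqP => xE;
      apply: Nx; rewrite ?xE; [left; right|right].
  have [df xdf dfM] : exists2 df, is_derive x 1 f df & `|df| <= M.
    by apply: fM => // Nx'; apply: Nx; left; left.
  have [r r0 Hr] := is_derive_increment e'0 xdf.
  exists r => // u v xru vxr au ux xv vb [n [us [vs [H1 H2 H3]]]].
  exists n, us, vs; split => //.
    move=> k kn; have [h1 h2 h3 h4] := H1 _ kn; split => //.
    by rewrite (le_trans h3)// (le_trans ux).
  (* Regular tag: both increments are measured from [x], where the derivative bound applies, and the
     lengths [x - u] and [v - x] add up. *)
  have -> : f v - f a = (f u - f a) + (f v - f x) - (f u - f x).
    rewrite -[RHS]addrA opprB [f v - f x + _]addrA subrK.
    by rewrite [RHS]addrC addrA subrK.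
  rewrite (le_trans (ler_normB _ _))// (le_trans (lerD (ler_normD _ _) (lexx _)))//.
  have hv : `|f v - f x| <= (M + e') * (v - x).
    have := Hr v; rewrite ger0_norm ?subr_ge0// ltrBlDl => /(_ vxr) /le_trans; apply.
    by rewrite ler_wpM2r ?subr_ge0// lerD2r.
  have hu : `|f u - f x| <= (M + e') * (x - u).
    have := Hr u; rewrite distrC ger0_norm ?subr_ge0// ltrBlDl -ltrBlDr.
    by move=> /(_ xru) /le_trans; apply; rewrite ler_wpM2r ?subr_ge0// lerD2r.
  rewrite (le_trans (lerD (lerD H3 hv) hu))//.
  by rewrite le_eqVlt; apply/orP; left; apply/eqP; ring.
(* The supremum [s] of the good points is itself a tag, so a good point just below it makes [v]
   good. As [v] exceeds [s] unless [s = b], this reaches [b]. *)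
pose S := [set x | a <= x <= b /\ good x].
have Sa : S a.
  split; first by rewrite lexx.
  exists 0%N, (fun=> a), (fun=> a); split => //.
  by rewrite !subrr normr0 mulr0 big_ord0 addr0.
have ubS : has_ubound S by exists b => x [/andP[]].
have supS : has_sup S by split; [exists a|].
set s := sup S.
have as_ : a <= s by apply: ub_le_sup.
have sb : s <= b by apply: ge_sup; [exists a|move=> x [/andP[]]].
have [r r0 step] := good_step s (introT andP (conj as_ sb)).
have [u [/andP[au ub] gu] su] := sup_adherent r0 supS.
have us : u <= s by apply: ub_le_sup => //; split => //; rewrite au.
pose v := Num.min b (s + r / 2).
have sv : s <= v by rewrite le_min sb lerDl divr_ge0// ltW.
have vb : v <= b by rewrite ge_min lexx.
have vsr : v < s + r.
  by rewrite gt_min ltrD2l ltr_pdivrMr// ltr_pMr// ltr1n orbT.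
have gv : good v by exact: (step u).
have vs : v <= s by apply: ub_le_sup => //; split => //; rewrite vb (le_trans as_).
have {gv} : good b.
  suff <- : v = b by [].
  move: vs; rewrite /v ge_min => /orP[bs|]; last first.
    by rewrite gerDl leNgt divr_gt0.
  by apply/min_idPl; rewrite (le_trans bs)// lerDl divr_ge0// ltW.
move=> [n [us' [vs' [H1 H2 H3]]]].
have tr := trivIset_seq_itv H2.
have He : \sum_(k < n) `|f (vs' k) - f (us' k)| < e / 2.
  apply: (H n (fun k => us' k) (fun k => vs' k)) => //.
    by move=> k; have [] := H1 k (ltn_ord k).
  have := @sum_itv_length_le _ U n (fun k => us' k) (fun k => vs' k)
    (open_measurable oU) (fun k => let: And4 _ h _ _ := H1 k (ltn_ord k) in h)
    tr (fun k => let: And4 _ _ _ h := H1 k (ltn_ord k) in h).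
  move=> /le_trans /(_ muU); rewrite lee_fin => /le_lt_trans; apply.
  by rewrite ltr_pdivrMr// ltr_pMr// ltr1n.
rewrite (le_trans H3)// mulrDl -addrA lerD2l [leRHS]splitr lerD//; last exact: ltW.
by rewrite /e' mulrAC ler_pdivrMr// ler_wpM2l ?divr_ge0 ?(ltW e0)// lerDl.
Qed.

(** * Primitives of Lebesgue measurable functions *)

(** Transports the exceptional set of the differential equation to the rescaled period. The
    pushforward of Lebesgue measure under the affine map, multiplied by [r], agrees with Lebesgue
    measure on half-open intervals, hence everywhere. *)
Lemma negligible_affine_preimage (R : realType) (c r : R) (N : set R) : 0 < r ->
  (@lebesgue_measure R).-negligible N ->
  (@lebesgue_measure R).-negligible [set s | N (c + r * s)].
Proof.
move=> r0 [M [mM M0 NM]].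
pose phi (s : measurableTypeR R) : measurableTypeR R := c + r * s.
have mphi : measurable_fun setT phi.
  apply: measurable_funD => //; exact: measurable_funM.
exists (phi @^-1` M); split; last by move=> s /NM.
  by rewrite -[X in measurable X]setTI; exact: mphi.
pose nu := mscale (NngNum (ltW r0)) (pushforward (@lebesgue_measure R) phi).
have nuE A : measurable A -> lebesgue_measure A = nu mphi A.
  apply: lebesgue_measure_unique => X [[a b] _ <-] /=.
  rewrite /nu /mscale /pushforward /=.
  rewrite [X in (_ * lebesgue_measure X)%E](_ : _ =
      `](a - c) / r, (b - c) / r]%classic); last first.
    apply/seteqP; split => s /=; rewrite !in_itv/= /phi => /andP[];
    rewrite ltr_pdivrMr// ler_pdivlMr// ltrBlDl lerBrDl (mulrC r);
    by move=> -> ->.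
  rewrite !lebesgue_measure_itv/= !lte_fin ltr_pM2r ?invr_gt0// ltrD2r.
  case: ifP => _; last by rewrite mule0.
  by rewrite -!EFinB -EFinM; congr EFin; field; rewrite gt_eqF.
have := nuE _ mM; rewrite M0 /nu /mscale /pushforward /=.
by move=> /esym/eqP; rewrite mule_eq0 eqe gt_eqF//= => /eqP.
Qed.

(* [N] collects the null sets by which the sets [f < q], [q] rational, differ
   from Borel sets. *)
Lemma lebesgue_measurable_borel_restriction (R : realType) (f : R -> R) :
  lebesgue_measurable_fun f ->
  exists2 N : set (measurableTypeR R), measurable N /\ lebesgue_measure N = 0 &
    measurable_fun setT ((f \_ (~` N)) : measurableTypeR R -> R).
Proof.
move=> mf.
have H (q : rat) : exists XN : set (measurableTypeR R) * set (measurableTypeR R),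
    [/\ measurable XN.1, measurable XN.2, lebesgue_measure XN.2 = 0 &
        forall x, ~ XN.2 x -> XN.1 x <-> f x < ratr q].
  have : measurable [set x : lebesgueType R | f x < ratr q].
    rewrite -[X in measurable X]setTI.
    rewrite -[X in setT `&` X]/(f @^-1` [set y | y < ratr q]); apply: mf => //.
    rewrite (_ : [set y | _] = `]-oo, ratr q[%classic).
      exact: measurable_itv.
    by apply/seteqP; split => y; rewrite /= in_itv.
  rewrite -[X in X -> _]/((@wlength R idfun)^*%mu.-cara.-measurable _).
  rewrite -completed_caratheodory_measurable g_sigma_completed_algebra_genE.
  move=> [X mX [M [M' [mM' M'0 MM']] E]].
  exists (X, M'); split => //= x nM'x.
  have -> : (f x < ratr q) = [set x | f x < ratr q] x :> Prop by [].
  rewrite -E; split; first by left.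
  by move=> [//|/MM'].
have [XN HXN] := choice H.
pose N := \bigcup_(n : nat) (XN (odflt 0 (unpickle n))).2.
have mN : measurable N.
  by apply: bigcupT_measurable => n; have [] := HXN (odflt 0 (unpickle n)).
have NXN q : (XN q).2 `<=` N.
  by move=> x; exists (pickle q) => //; rewrite pickleK.
exists N; first split => //.
  apply: (@measure_negligible _ _ _ (@lebesgue_measure R)) => //.
  apply: negligible_bigcup => n; have [_ m2 X0 _] := HXN (odflt 0 (unpickle n)).
  exact/negligibleP.
apply: (measurability _ (RGenInftyO.measurableE R)) => _ [_ [r ->] <-].
rewrite setTI.
(* On [N] the restriction takes the default value [0], so [N] is part of the preimage of []-oo, r[]
   exactly when [0 < r]. *)
rewrite (_ : _ @^-1` _ =
   \bigcup_(q : rat) ((if (ratr q : R) <= r then (XN q).1 else set0) `\` N) `|`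
   (if 0 < r then N else set0)).
  apply: measurableU; last by case: ifP.
  apply: bigcupT_measurable_rat => q; apply: measurableD => //.
  by case: ifP => // _; have [] := HXN q.
apply/seteqP; split => x /=; rewrite in_itv/= patchE.
  case: ifPn => [|/negP]; rewrite inE/= => xN; last first.
    by move=> r0; right; rewrite r0; exact: contrapT.
  move=> /rat_in_itvoo[q]; rewrite in_itv/= => /andP[fq qr].
  left; exists q => //; split => //; rewrite ltW//.
  have [_ _ _ /(_ x)] := HXN q.
  by move=> /(_ (fun h => xN (NXN q _ h))) [_]; apply.
move=> [[q _ [+ xN]]|].
  case: ifPn => // qr Xx; rewrite ifT ?inE//.
  have [_ _ _ /(_ x)] := HXN q.
  by move=> /(_ (fun h => xN (NXN q _ h))) [/(_ Xx) fq _]; exact: lt_le_trans qr.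
case: ifPn => // r0 Nx; rewrite ifF//; apply/negP; rewrite inE => /=.
exact.
Qed.

Lemma borel_lebesgue_measurable (R : realType) (D : set R) :
  measurable (D : set (measurableTypeR R)) ->
  measurable (D : set (lebesgueType R)).
Proof. exact: sub_caratheodory. Qed.

Lemma lebesgue_measurable_itv (R : realType) (i : interval R) :
  measurable ([set` i] : set (lebesgueType R)).
Proof. by apply: borel_lebesgue_measurable; exact: measurable_itv. Qed.

Lemma borel_lebesgue_measurable_fun (R : realType) (f : measurableTypeR R -> R) :
  measurable_fun setT f -> lebesgue_measurable_fun f.
Proof.
move=> mf _ Y mY; rewrite setTI; apply: borel_lebesgue_measurable.
by have := mf measurableT Y mY; rewrite setTI.
Qed.

Lemma lebesgue_measure_itv_lty (R : realType) (a b : R) :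
  (@lebesgue_measure R `[a, b]%classic < +oo)%E.
Proof.
by rewrite lebesgue_measure_itv /=; case: ifP => //; rewrite -EFinB ltry.
Qed.

Lemma completed_integrable_itv (R : realType) (f : R -> R) (a b K : R) :
  lebesgue_measurable_fun f -> (forall t, a <= t <= b -> `|f t| <= K) ->
  (@completed_lebesgue_measure R).-integrable `[a, b] (EFin \o f).
Proof.
move=> mf fK; apply: measurable_bounded_integrable.
- exact: lebesgue_measurable_itv.
- exact: lebesgue_measure_itv_lty.
- exact: measurable_funTS.
- exists K; split; first exact: num_real.
  move=> M KM t /=; rewrite in_itv/= => tab.
  exact: le_trans (fK _ tab) (ltW KM).
Qed.

(** The identity from the Lebesgue to the Borel sigma-algebra is measurable and pushes the completed
    measure forward to [lebesgue_measure], so this is a change of variables. *)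
Lemma completed_Rintegral_borel (R : realType) (g : measurableTypeR R -> R)
    (a b K : R) :
  measurable_fun setT g -> (forall t, a <= t <= b -> `|g t| <= K) ->
  \int[@completed_lebesgue_measure R]_(t in `[a, b]) g t =
  \int[@lebesgue_measure R]_(t in `[a, b]) g t.
Proof.
move=> mg gK; congr fine.
pose phi (x : lebesgueType R) : measurableTypeR R := x.
have mphi : measurable_fun setT phi.
  by move=> _ Y mY; rewrite setTI; exact: borel_lebesgue_measurable.
rewrite -[LHS](@integral_pushforward _ _ _ _ _ phi mphi
  (@completed_lebesgue_measure R) `[a, b]%classic (fun x => (g x)%:E)).
- exact: eq_measure_integral.
- exact/measurable_EFinP.
- apply: (@completed_integrable_itv _ _ _ _ K) => //.
  exact: borel_lebesgue_measurable_fun.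
- exact: measurable_itv.
Qed.

Lemma completed_Rintegral_ae_eq (R : realType) (f g : R -> R) (a b : R)
    (N : set R) :
  lebesgue_measurable_fun f -> lebesgue_measurable_fun g ->
  (@lebesgue_measure R).-negligible N ->
  (forall t, a <= t <= b -> ~ N t -> f t = g t) ->
  \int[@completed_lebesgue_measure R]_(t in `[a, b]) f t =
  \int[@completed_lebesgue_measure R]_(t in `[a, b]) g t.
Proof.
move=> mf mg N0 fg; congr fine; apply: ae_eq_integral.
- exact: lebesgue_measurable_itv.
- exact/measurable_EFinP/measurable_funTS.
- exact/measurable_EFinP/measurable_funTS.
- apply: negligibleS ((completed_negligible N).2 N0) => t /= /not_implyP[].
  rewrite in_itv/= => tab fgt; apply: contrapT => Nt; apply: fgt.
  by rewrite fg.
Qed.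

Section lebesgue_primitive.
Context (R : realType) (f : R -> R) (L K : R).
Hypotheses (L_ge0 : 0 <= L) (mf : lebesgue_measurable_fun f)
  (fK : forall t, 0 <= t <= L -> `|f t| <= K).

Local Notation F s := (\int[@completed_lebesgue_measure R]_(t in `[0, s]) f t).

Let K_ge0 : 0 <= K.
Proof. by apply: le_trans (fK (t := 0) _); rewrite ?lexx. Qed.

(** Cutting [f] off outside [[0, L]] before choosing the Borel representative makes the bound [K]
    global. *)
Let exists_borel : exists2 g : measurableTypeR R -> R,
  measurable_fun setT g /\ (forall t, `|g t| <= K) &
  exists2 N : set R, (@lebesgue_measure R).-negligible N &
    forall t, 0 <= t <= L -> ~ N t -> f t = g t.
Proof.
have mfL : lebesgue_measurable_fun (f \_ `[0, L]).
  apply: (measurable_restrictT _ _).1; first exact: lebesgue_measurable_itv.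
  exact: measurable_funTS.
have [N [mN N0] mg] := lebesgue_measurable_borel_restriction mfL.
exists ((f \_ `[0, L]) \_ (~` N)); first split => //.
  move=> t; rewrite patchE; case: ifPn => _; last by rewrite normr0.
  rewrite patchE; case: ifPn => [|_]; last by rewrite normr0.
  by rewrite inE/= in_itv/=; exact: fK.
exists N; first exact/negligibleP.
move=> t tL Nt; rewrite patchE ifT; last by rewrite inE.
by rewrite patchE ifT// inE/= in_itv.
Qed.

Let bounded_borel_integrable (g : measurableTypeR R -> R) :
  measurable_fun setT g -> (forall t, `|g t| <= K) ->
  forall a b, (@lebesgue_measure R).-integrable `[a, b] (EFin \o g).
Proof.
move=> mg gK a b; apply: measurable_bounded_integrable.
- exact: measurable_itv.
- exact: lebesgue_measure_itv_lty.
- exact: measurable_funTS.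
- exists K; split; first exact: num_real.
  by move=> M KM x _ /=; rewrite (le_trans (gK _))// ltW.
Qed.

Let primitive_borel (g : measurableTypeR R -> R) (N : set R) :
  measurable_fun setT g -> (forall t, `|g t| <= K) ->
  (@lebesgue_measure R).-negligible N ->
  (forall t, 0 <= t <= L -> ~ N t -> f t = g t) ->
  forall y, y <= L -> F y = \int[@lebesgue_measure R]_(x in `[0, y]) g x.
Proof.
move=> mg gK N0 fg y yL; rewrite -(@completed_Rintegral_borel _ _ _ _ K)//.
apply: (@completed_Rintegral_ae_eq _ _ _ _ _ N) => //.
  exact: borel_lebesgue_measurable_fun.
by move=> x /andP[x0 xy]; apply: fg; rewrite x0 (le_trans xy).
Qed.

Lemma lebesgue_primitive_lipschitz s t : 0 <= s -> s <= t -> t <= L ->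
  `|F t - F s| <= K * (t - s).
Proof.
have [g [mg gK] [N N0 fg]] := exists_borel.
have FG := primitive_borel mg gK N0 fg.
have ig := bounded_borel_integrable mg gK.
move=> s0 st tL; rewrite !FG ?(le_trans st)// (Rintegral_itvB (ig 0 t)) ?bnd_simp//.
have mst : measurable (`]s, t]%classic : set (measurableTypeR R)).
  exact: measurable_itv.
have ist : (@lebesgue_measure R).-integrable `]s, t] (EFin \o g).
  apply: integrableS (ig s t); [exact: measurable_itv..|].
  exact: subset_itv_oc_cc.
rewrite (le_trans (le_normr_Rintegral mst ist))//.
have iK : (@lebesgue_measure R).-integrable `]s, t] (EFin \o cst K).
  apply: (@integrableS _ _ _ (@lebesgue_measure R) `[s, t]%classic);
    [exact: measurable_itv..|exact: subset_itv_oc_cc|].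
  - apply: measurable_bounded_integrable; first exact: measurable_itv.
    + exact: lebesgue_measure_itv_lty.
    + exact: measurable_cst.
    + by exists K; split => [|M KM x _ /=]; rewrite ?num_real// ger0_norm// ltW.
rewrite (@le_trans _ _ (\int[@lebesgue_measure R]_(x in `]s, t]) K))//.
  by apply: le_Rintegral => //; exact: (integrable_norm ist).
rewrite Rintegral_cst; last exact: measurable_itv.
rewrite [X in fine X](@lebesgue_measure_itv R `]s, t]) /= lte_fin.
case: ltP => //= _.
by rewrite mulr0 mulr_ge0// subr_ge0.
Qed.

(** Lebesgue differentiation is available for the Borel representative [g]; the exceptional set also
    has to absorb the points where [f] and [g] differ. *)
Lemma lebesgue_primitive_derive :
  exists2 N : set R, (@lebesgue_measure R).-negligible N &
    forall s, 0 < s < L -> ~ N s -> is_derive s 1 (fun s => F s) (f s).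
Proof.
have [g [mg gK] [N N0 fg]] := exists_borel.
have FG := primitive_borel mg gK N0 fg.
have ig := bounded_borel_integrable mg gK.
have lg : locally_integrable [set: R] g.
  split => //; first exact: openT.
  move=> C _ cC; have [M [_ CM]] := compact_bounded cC.
  have CI : C `<=` `[- (M + 1), M + 1].
    move=> x Cx /=; rewrite in_itv/= -ler_norml; apply: (CM (M + 1)) => //.
    by rewrite ltrDl.
  have := ig (- (M + 1)) (M + 1) => /integrableP[_]; apply: le_lt_trans.
  apply: ge0_subset_integral => //; first exact: compact_measurable.
  apply/measurable_EFinP; apply: measurableT_comp; first exact: normr_measurable.
  exact: measurable_funTS.
pose G (y : R) : R := \int[@lebesgue_measure R]_(t in `[0, y]) g t.
have [N1 [mN1 N10 N1G]] := @FTC1 R g (BLeft 0) (fun y => ig 0 y) lg.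
exists (N `|` N1); first by apply: negligibleU => //; exists N1; split.
move=> s /andP[s0 sL] /not_orP[Ns N1s].
have [dG GE] : derivable G s 1 /\ derive1 G s = g s.
  apply: contrapT => h; apply: N1s; apply: N1G => /= h'; apply: h.
  by apply: h'; rewrite lte_fin.
have -> : f s = g s by apply: fg Ns; rewrite !ltW.
(* The two primitives are known to agree only up to [L], which suffices near a point [s < L]. *)
apply: (@near_eq_is_derive _ _ _ G).
  by near=> y; rewrite FG// ltW//; near: y; exact: lt_nbhsl.
by split; [exact: dG|rewrite -derive1E; exact: GE].
Unshelve. all: by end_near. Qed.

End lebesgue_primitive.

(** * Matrix-valued functions *)

Lemma mx_norm_leP (R : realType) m n (A : 'M[R]_(m, n)) (c : R) : 0 <= c ->
  `|A| <= c <-> forall i j, `|A i j| <= c.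
Proof.
move=> c0; rewrite /Num.Def.normr/= mx_normrE; split=> [Ac i j|Ac].
  exact: le_trans (le_bigmax _ (fun ij => `|A ij.1 ij.2|) (i, j)) Ac.
by apply: bigmax_le => // -[i j] _; exact: Ac.
Qed.

Lemma mx_norm_entry (R : realType) m n (A : 'M[R]_(m, n)) i j :
  `|A i j| <= `|A|.
Proof. exact: (mx_norm_leP A (normr_ge0 _)).1. Qed.

(** The norm is the largest entry in modulus, so a product costs a factor equal to the inner
    dimension. This is where the factors [2] in later constants come from. *)
Lemma mx_norm_mulmx (R : realType) m n p (A : 'M[R]_(m, n))
    (B : 'M[R]_(n, p)) : `|A *m B| <= n%:R * `|A| * `|B|.
Proof.
apply/mx_norm_leP; first by rewrite !mulr_ge0.
move=> i j; rewrite mxE (le_trans (ler_norm_sum _ _ _))//.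
rewrite (@le_trans _ _ (\sum_(k < n) `|A| * `|B|))//.
  by apply: ler_sum => k _; rewrite normrM ler_pM// mx_norm_entry.
by rewrite sumr_const card_ord -mulrA mulr_natl.
Qed.

Lemma is_derive_mxP (R : realType) m n (F : R -> 'M[R]_(m, n))
    (dF : 'M[R]_(m, n)) (t : R) :
  is_derive t 1 F dF <-> forall i j, is_derive t 1 (fun s => F s i j) (dF i j).
Proof.
split=> [[dFt FE] i j|dF_].
  have dij := (derivable_mxP F t 1).1 dFt i j.
  by split => //; rewrite -FE derive_mx// mxE.
have dFt : derivable F t 1.
  by apply/derivable_mxP => i j; have [] := dF_ i j.
split => //; rewrite derive_mx//; apply/matrixP => i j; rewrite mxE.
by have [] := dF_ i j.
Qed.

Lemma is_derive_mulmx (R : realType) m n p (F : R -> 'M[R]_(m, n))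
    (G : R -> 'M[R]_(n, p)) dF dG (t : R) :
  is_derive t 1 F dF -> is_derive t 1 G dG ->
  is_derive t 1 (fun s => F s *m G s) (dF *m G t + F t *m dG).
Proof.
move=> /is_derive_mxP dF_ /is_derive_mxP dG_; apply/is_derive_mxP => i j.
have -> : (fun s => (F s *m G s) i j) =
          \sum_(k < n) ((fun s => F s i k) * (fun s => G s k j)).
  by apply/funext => s; rewrite mxE fct_sumE.
apply: (is_derive_eq (is_derive_sum (fun k => is_deriveM (dF_ i k) (dG_ k j)))).
rewrite !mxE -big_split/=; apply: eq_bigr => k _.
by rewrite addrC [G t k j *: _]mulrC.
Qed.

Lemma is_derive_mulmxl (R : realType) m n p (M : 'M[R]_(m, n))
    (G : R -> 'M[R]_(n, p)) dG (t : R) :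
  is_derive t 1 G dG -> is_derive t 1 (fun s => M *m G s) (M *m dG).
Proof.
move=> dG_; have := is_derive_mulmx (is_derive_cst M t 1) dG_.
by rewrite mul0mx add0r.
Qed.

Lemma is_derive_mulmxr (R : realType) m n p (M : 'M[R]_(n, p))
    (F : R -> 'M[R]_(m, n)) dF (t : R) :
  is_derive t 1 F dF -> is_derive t 1 (fun s => F s *m M) (dF *m M).
Proof.
move=> dF_; have := is_derive_mulmx dF_ (is_derive_cst M t 1).
by rewrite mulmx0 addr0.
Qed.

Definition segment_lipschitz (R : realType) (V : normedModType R) (a b K : R)
    (f : R -> V) :=
  forall s t, a <= s -> s <= t -> t <= b -> `|f t - f s| <= K * (t - s).

Lemma lipschitz_absolutely_continuous (R : realType) (V : normedModType R)
    (a b K : R) (f : R -> V) :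
  segment_lipschitz a b K f -> absolutely_continuous a b f.
Proof.
move=> fK e e0; have K1 : 0 < `|K| + 1 by rewrite ltr_wpDl.
exists (e / (`|K| + 1)); first exact: divr_gt0.
move=> n u v uv _; rewrite ltr_pdivlMr// mulrC; apply: le_lt_trans.
rewrite mulr_sumr; apply: ler_sum => k _; have [au [ukv vb]] := uv k.
rewrite (le_trans (fK _ _ _ _ _))// ler_wpM2r ?subr_ge0//.
by rewrite (le_trans (ler_norm _))// lerDl.
Qed.

Lemma absolutely_continuousB (R : realType) (V : normedModType R)
    (a b : R) (f g : R -> V) :
  absolutely_continuous a b f -> absolutely_continuous a b g ->
  absolutely_continuous a b (f - g).
Proof.
move=> acf acg e e0; have e20 : 0 < e / 2 by rewrite divr_gt0.
have [d d0 fd] := acf _ e20; have [d' d'0 gd'] := acg _ e20.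
exists (Num.min d d'); first by rewrite lt_min d0.
move=> n u v uv tr; rewrite lt_min => /andP[ud ud'].
rewrite [ltRHS]splitr; apply: le_lt_trans
  (ltrD (fd _ _ _ uv tr ud) (gd' _ _ _ uv tr ud')).
rewrite -big_split/=; apply: ler_sum => k _.
have -> : (f - g) (v k) - (f - g) (u k) =
          f (v k) - f (u k) - (g (v k) - g (u k)).
  by rewrite !fctE !opprB addrACA [RHS]addrACA [- g (v k) - _]addrC.
exact: ler_normB.
Qed.

Lemma absolutely_continuousS (R : realType) (V : normedModType R)
    (a b a' b' : R) (f : R -> V) : a <= a' -> b' <= b ->
  absolutely_continuous a b f -> absolutely_continuous a' b' f.
Proof.
move=> aa bb acf e /acf[d d0 fd]; exists d => // n u v uv tr.
apply: fd => // k; have [au [ukv vb]] := uv k.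
by rewrite (le_trans aa)// (le_trans vb).
Qed.

(** A step of length [d / 2] changes [f] by less than [1], and a fixed number of such steps covers
    the segment. *)
Lemma absolutely_continuous_bounded (R : realType) (V : normedModType R)
    (a b : R) (f : R -> V) :
  absolutely_continuous a b f -> exists M, forall t, a <= t <= b -> `|f t| <= M.
Proof.
move=> /(_ 1 ltr01)[d d0 fd]; have d20 : 0 < d / 2 by rewrite divr_gt0.
have step s t : a <= s -> s <= t -> t <= b -> t - s < d -> `|f t - f s| < 1.
  move=> as_ st tb tsd; have := fd 1%N (fun=> s) (fun=> t).
  rewrite !big_ord1; apply => //.
  by move=> i j _ _ _; rewrite !ord1.
have bnd n t : a <= t -> t <= b -> t <= a + n%:R * (d / 2) ->
    `|f t| <= `|f a| + n%:R.
  elim: n t => [|n IHn] t at_ tb.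
    by rewrite mul0r !addr0 => ta; rewrite (@le_anti _ _ t a)// ta.
  rewrite -natr1 mulrDl mul1r addrA => tn.
  have [tad|tad] := lerP (t - d / 2) a.
    have : `|f t - f a| < 1.
      apply: step => //; rewrite ltrBlDl.
      by move: tad; rewrite lerBlDr => /le_lt_trans; apply;
        rewrite ltrD2l ltr_pdivrMr// ltr_pMr// ltr1n.
    move=> ta; rewrite -[f t](subrK (f a)) (le_trans (ler_normD _ _))//.
    by rewrite addrC lerD2l (le_trans (ltW ta))// lerDr.
  have : `|f t - f (t - d / 2)| < 1.
    apply: step => //; first exact: ltW.
      by rewrite gerBl ltW.
    by rewrite opprB addrC subrK ltr_pdivrMr// ltr_pMr// ltr1n.
  move=> ta; rewrite -[f t](subrK (f (t - d / 2))) (le_trans (ler_normD _ _))//.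
  rewrite addrC addrA lerD ?(ltW ta)// IHn ?(ltW tad)//.
    by rewrite (le_trans _ tb)// gerBl ltW.
  by rewrite lerBlDr.
exists (`|f a| + (Num.bound ((b - a) / (d / 2)))%:R) => t /andP[at_ tb].
apply: bnd => //; rewrite -lerBlDl -ler_pdivrMr//.
rewrite (@le_trans _ _ ((b - a) / (d / 2)))//.
  by rewrite ler_wpM2r ?invr_ge0 ?(ltW d20)// lerD2r.
by rewrite ltW// archi_boundP// divr_ge0 ?(ltW d20)// subr_ge0 (le_trans at_).
Qed.

(** The form in which the mean value inequality is applied from here on: with [M > 0] for error
    bounds, with [M = 0] to prove that two functions coincide. *)
Lemma absolutely_continuous_compare (R : realType) (V : normedModType R)
    (b M : R) (N : set R) (f g df dg : R -> V) : 0 <= M ->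
  absolutely_continuous 0 b f -> absolutely_continuous 0 b g ->
  (@lebesgue_measure R).-negligible N ->
  (forall s, 0 < s < b -> ~ N s ->
     [/\ is_derive s 1 f (df s), is_derive s 1 g (dg s) & `|df s - dg s| <= M]) ->
  f 0 = g 0 -> forall s, 0 <= s <= b -> `|f s - g s| <= M * s.
Proof.
move=> M0 acf acg N0 fg fg0 s /andP[s0 sb].
have : `|(f - g) s - (f - g) 0| <= M * (s - 0).
  apply: (absolutely_continuous_increment M0 s0 _ N0).
    apply: (absolutely_continuousS (lexx 0) sb).
    exact: absolutely_continuousB.
  move=> x /andP[x0 xs] Nx; have [|dfx dgx Mx] := fg x _ Nx.
    by rewrite x0 (lt_le_trans xs).
  by exists (df x - dg x) => //; exact: is_deriveB.
by rewrite subr0 !fctE fg0 subrr subr0.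
Qed.

Section mx_primitive.
Context (R : realType) (G : R -> 'M[R]_2) (L K : R).
Hypotheses (L_ge0 : 0 <= L) (mG : mx_measurable G)
  (GK : forall t, 0 <= t <= L -> `|G t| <= K).

Let K_ge0 : 0 <= K.
Proof. by apply: le_trans (GK (t := 0) _); rewrite ?lexx. Qed.

Let GK_entry i j t : 0 <= t <= L -> `|G t i j| <= K.
Proof. by move=> /GK; apply: le_trans; exact: mx_norm_entry. Qed.

Lemma mx_int_point (x : R) : mx_int x x G = 0.
Proof.
apply/matrixP => i j; rewrite !mxE.
rewrite (@completed_Rintegral_ae_eq _ _ (cst 0) _ _ [set x])//.
- by rewrite /Rintegral integral0.
- exact: measurable_cst.
- by exists [set x]; split => //; exact: lebesgue_measure_set1.
- by move=> t; rewrite -eq_le => /eqP -> /(_ erefl).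
Qed.

Lemma mx_primitive_lipschitz : segment_lipschitz 0 L K (fun s => mx_int 0 s G).
Proof.
move=> s t s0 st tL; apply/mx_norm_leP.
  by rewrite mulr_ge0 ?subr_ge0.
move=> i j; rewrite !mxE.
by apply: (lebesgue_primitive_lipschitz L_ge0 (mG i j) (@GK_entry i j)).
Qed.

Lemma mx_primitive_norm s : 0 <= s <= L -> `|mx_int 0 s G| <= K * s.
Proof.
move=> /andP[s0 sL]; have := mx_primitive_lipschitz (lexx 0) s0 sL.
by rewrite mx_int_point !subr0.
Qed.

Lemma mx_primitive_derive : exists2 N : set R,
  (@lebesgue_measure R).-negligible N &
  forall s, 0 < s < L -> ~ N s -> is_derive s 1 (fun s => mx_int 0 s G) (G s).
Proof.
have H ij : exists N : set R, (@lebesgue_measure R).-negligible N /\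
    forall s, 0 < s < L -> ~ N s ->
      is_derive s 1 (fun s => \int[@completed_lebesgue_measure R]_(t in `[0, s])
        G t ij.1 ij.2) (G s ij.1 ij.2).
  have [N N0 NG] := lebesgue_primitive_derive L_ge0 (mG ij.1 ij.2)
    (@GK_entry ij.1 ij.2).
  by exists N.
have [N HN] := choice H.
exists (\big[setU/set0]_(ij : 'I_2 * 'I_2) N ij).
  elim/big_ind : _; [exact: negligible_set0|by move=> A B nA nB; apply: negligibleU|].
  by move=> ij _; have [] := HN ij.
move=> s sL Ns; apply/is_derive_mxP => i j.
have [_ /(_ s sL)] := HN (i, j).
rewrite (_ : (fun s => mx_int 0 s G i j) =
  fun s => \int[@completed_lebesgue_measure R]_(t in `[0, s]) G t i j); last first.
  by apply/funext => y; rewrite mxE.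
apply => Nij; apply: Ns.
by rewrite -bigcup_seq; exists (i, j) => //=; rewrite mem_index_enum.
Qed.

End mx_primitive.

Lemma mx_measurable_mulmx (R : realType) (F G : R -> 'M[R]_2) :
  mx_measurable F -> mx_measurable G -> mx_measurable (fun s => F s *m G s).
Proof.
move=> mF mG i j.
rewrite /lebesgue_measurable_fun (_ : (fun t => _) =
  (fun t : lebesgueType R => \sum_k F t i k * G t k j)); last first.
  by apply/funext => t; rewrite mxE.
apply: measurable_sum => k; apply: measurable_funM; [exact: mF|exact: mG].
Qed.

Lemma mx_measurable_lipschitz (R : realType) (F : R -> 'M[R]_2) (K : R) :
  (forall s t, `|F t - F s| <= K * `|t - s|) -> mx_measurable F.
Proof.
move=> FK i j; apply: borel_lebesgue_measurable_fun.
apply: continuous_measurable_fun => s; apply/cvgrPdist_le => e e0.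
have K1 : 0 < `|K| + 1 by rewrite ltr_wpDl.
apply/nbhs_ballP; exists (e / (`|K| + 1)); first exact: divr_gt0.
move=> t /= /ltW st.
have := mx_norm_entry (F t - F s) i j; rewrite !mxE distrC => /le_trans; apply.
rewrite (le_trans (FK s t))// (@le_trans _ _ ((`|K| + 1) * `|t - s|))//.
  by rewrite ler_wpM2r// (le_trans (ler_norm _))// lerDl.
by rewrite -ler_pdivlMl// mulrC distrC.
Qed.

(** * Expansion over one period *)

Lemma segment_lipschitz_cst (R : realType) (V : normedModType R) (a b : R)
    (v : V) : segment_lipschitz a b 0 (cst v).
Proof. by move=> s t _ _ _; rewrite subrr normr0 mul0r. Qed.

Lemma segment_lipschitzD (R : realType) (V : normedModType R) (a b K1 K2 : R)
    (f g : R -> V) : segment_lipschitz a b K1 f -> segment_lipschitz a b K2 g ->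
  segment_lipschitz a b (K1 + K2) (f + g).
Proof.
move=> fK gK s t as_ st tb; rewrite !fctE opprD addrACA mulrDl.
by rewrite (le_trans (ler_normD _ _))// lerD ?fK ?gK.
Qed.

Lemma segment_lipschitzZ (R : realType) (V : normedModType R) (a b K c : R)
    (f : R -> V) : segment_lipschitz a b K f ->
  segment_lipschitz a b (`|c| * K) (c \*: f).
Proof.
move=> fK s t as_ st tb.
by rewrite -[X in `|X|]scalerBr normrZ -mulrA ler_wpM2l// fK.
Qed.

Lemma segment_lipschitz_mulmx (R : realType) m n p (a b K1 K2 M1 M2 : R)
    (f : R -> 'M[R]_(m, n)) (g : R -> 'M[R]_(n, p)) :
  (forall s, a <= s <= b -> `|f s| <= M1) ->
  (forall s, a <= s <= b -> `|g s| <= M2) ->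
  segment_lipschitz a b K1 f -> segment_lipschitz a b K2 g ->
  segment_lipschitz a b (n%:R * K1 * M2 + n%:R * M1 * K2) (fun s => f s *m g s).
Proof.
move=> fM gM fK gK s t as_ st tb.
have -> : f t *m g t - f s *m g s = (f t - f s) *m g t + f s *m (g t - g s).
  by rewrite mulmxBl mulmxBr addrA subrK.
rewrite mulrDl (le_trans (ler_normD _ _))// lerD//.
  rewrite (le_trans (mx_norm_mulmx _ _))//.
  rewrite -!mulrA [M2 * _]mulrC !mulrA ler_pM ?mulr_ge0//.
    by rewrite -mulrA ler_wpM2l// fK.
  by rewrite gM// tb (le_trans as_).
rewrite (le_trans (mx_norm_mulmx _ _))// -[leRHS]mulrA ler_pM ?mulr_ge0//; last exact: gK.
by rewrite ler_wpM2l// fM// as_ (le_trans st).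
Qed.

Lemma segment_lipschitz_mulmxr (R : realType) m n p (a b K : R)
    (f : R -> 'M[R]_(m, n)) (M : 'M[R]_(n, p)) : segment_lipschitz a b K f ->
  segment_lipschitz a b (n%:R * K * `|M|) (fun s => f s *m M).
Proof.
move=> fK s t as_ st tb; rewrite -mulmxBl (le_trans (mx_norm_mulmx _ _))//.
by rewrite [leRHS]mulrAC ler_wpM2r// -mulrA ler_wpM2l// fK.
Qed.

Section one_period.
Context (R : realType) (A : R -> 'M[R]_2) (L a : R).
Hypotheses (L_ge0 : 0 <= L) (mA : mx_measurable A) (Aa : forall t, `|A t| <= a).

Let B s := mx_int 0 s A.
Let D s := mx_int 0 s (fun u => A u *m B u).

Let a_ge0 : 0 <= a.
Proof. exact: le_trans (normr_ge0 _) (Aa 0). Qed.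

Lemma mx_primitive_measurable : mx_measurable B.
Proof.
(* For [s < 0] the interval [[0, s]] is empty and the integral is [0]. Thus [B] is Lipschitz on the
   whole line, as its global measurability requires. *)
have B_neg s : s < 0 -> B s = 0.
  move=> s0; apply/matrixP => i j; rewrite !mxE set_itv_ge ?Rintegral_set0//.
  by rewrite bnd_simp -ltNge.
apply: (@mx_measurable_lipschitz _ _ a).
suff H s t : s <= t -> `|B t - B s| <= a * (t - s).
  move=> s t; have [st|ts] := leP s t.
    by rewrite ger0_norm ?subr_ge0//; exact: H.
  by rewrite distrC (ltr0_norm (_ : t - s < 0)) ?subr_lt0// opprB H// ltW.
move=> st; have [s0|s0] := leP 0 s.
  by apply: (@mx_primitive_lipschitz _ _ t) => //; exact: le_trans st.
rewrite (B_neg s)// subr0; have [t0|t0] := leP 0 t.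
  have tt : 0 <= t <= t by rewrite t0 lexx.
  rewrite (le_trans (mx_primitive_norm t0 mA (fun x _ => Aa x) tt))//.
  by rewrite ler_wpM2l// lerDl oppr_ge0 ltW.
by rewrite B_neg// normr0 mulr_ge0// subr_ge0.
Qed.

Let Ba s : 0 <= s <= L -> `|B s| <= a * L.
Proof.
move=> sL; rewrite (le_trans (mx_primitive_norm L_ge0 mA (fun x _ => Aa x) sL))//.
by rewrite ler_wpM2l//; case/andP: sL.
Qed.

Let BK : segment_lipschitz 0 L a B.
Proof. exact: mx_primitive_lipschitz. Qed.

Let mAB : mx_measurable (fun u => A u *m B u).
Proof. by apply: mx_measurable_mulmx => //; exact: mx_primitive_measurable. Qed.

Let mBA : mx_measurable (fun u => B u *m A u).
Proof. by apply: mx_measurable_mulmx => //; exact: mx_primitive_measurable. Qed.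

Let ABa s : 0 <= s <= L -> `|A s *m B s| <= 2 * a * (a * L).
Proof.
move=> sL; rewrite (le_trans (mx_norm_mulmx _ _))//.
by rewrite ler_pM ?mulr_ge0 ?ler_wpM2l// Ba.
Qed.

Let BAa s : 0 <= s <= L -> `|B s *m A s| <= 2 * a * (a * L).
Proof.
move=> sL; rewrite (le_trans (mx_norm_mulmx _ _))// mulrAC.
by rewrite ler_pM ?mulr_ge0 ?ler_wpM2l// Ba.
Qed.

Let DK : segment_lipschitz 0 L (2 * a * (a * L)) D.
Proof. exact: mx_primitive_lipschitz. Qed.

Let B0 : B 0 = 0. Proof. exact: mx_int_point. Qed.

Let D0 : D 0 = 0. Proof. exact: mx_int_point. Qed.

Lemma one_period_expansion (Y : R -> 'M[R]_2) (e : R) (N : set R) :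
  0 <= e -> absolutely_continuous 0 L Y ->
  (@lebesgue_measure R).-negligible N ->
  (forall s, 0 < s < L -> ~ N s -> is_derive s 1 Y (e *: (A s *m Y s))) ->
  2 * e * a * L <= 2^-1 ->
  `|Y L - (1%:M + e *: B L + e ^+ 2 *: D L) *m Y 0|
    <= 2 * (2 * e * a * L) ^+ 3 * `|Y 0|.
Proof.
move=> e0 acY N0 dY; set c := 2 * e * a * L => c12.
have c0 : 0 <= c by rewrite !mulr_ge0.
have [N1 N10 dB] := mx_primitive_derive L_ge0 mA (fun t _ => Aa t).
have [N2 N20 dD] := mx_primitive_derive L_ge0 mAB ABa.
have eAY s (M : 'M[R]_2) d : `|M| <= d -> `|e *: (A s *m M)| <= 2 * e * a * d.
  move=> Md; rewrite normrZ ger0_norm// (le_trans (ler_wpM2l e0 (mx_norm_mulmx _ _)))//.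
  rewrite -!mulrA [2 * (e * _)]mulrCA ler_wpM2l// ler_wpM2l//.
  by rewrite ler_pM.
have L0L : 0 <= L <= L by rewrite L_ge0 lexx.
(* A derivative [e A W] with [|W| <= M] moves a function by at most [c * M] over the period, so each
   comparison below gains one factor [c]. *)
have sleL M s : 0 <= M -> 0 <= s <= L -> 2 * e * a * M * s <= c * M.
  move=> M0 /andP[s0 sL]; rewrite /c mulrAC ler_wpM2r// ler_wpM2l//.
  by rewrite !mulr_ge0.
(* Finite because [Y] is absolutely continuous; only this qualitative fact is available before [m]
   is estimated. *)
pose m := sup [set `|Y s| | s in `[0, L]].
have [M0 YM0] := absolutely_continuous_bounded acY.
have supY : has_sup [set `|Y s| | s in `[0, L]].
  split; first by exists `|Y 0|, 0 => //=; rewrite in_itv/= lexx.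
  by exists M0 => _ [s /= + <-]; rewrite in_itv/=; exact: YM0.
have Ym s : 0 <= s <= L -> `|Y s| <= m.
  by move=> sL; apply: ub_le_sup; [case: supY|exists s => //=; rewrite in_itv].
have m0 : 0 <= m by apply: le_trans (Ym 0 _); rewrite ?lexx.
have Y1 s : 0 <= s <= L -> `|Y s - Y 0| <= c * m.
  move=> sL; apply: le_trans (sleL _ _ m0 sL).
  have em0 : 0 <= 2 * e * a * m by rewrite !mulr_ge0.
  have acc : absolutely_continuous 0 L (cst (Y 0)).
    exact/lipschitz_absolutely_continuous/segment_lipschitz_cst.
  apply: (absolutely_continuous_compare em0 acY acc N0
    (df := fun s => e *: (A s *m Y s)) (dg := cst 0) _ _ sL); last by [].
  move=> x xL Nx; split; [exact: dY|exact: is_derive_cst|].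
  rewrite subr0; apply: eAY; apply: Ym; case/andP: xL => x0 xL.
  by rewrite !ltW.
have {m0} {}Y1 s : 0 <= s <= L -> `|Y s - Y 0| <= 2 * c * `|Y 0|.
  (* From [m <= |Y 0| + c * m] with [c <= 1/2], the term in [m] is absorbed on the left. *)
  have m2 : m <= 2 * `|Y 0|.
    have : m <= `|Y 0| + c * m.
      apply: ge_sup; first by case: supY.
      move=> _ [u /= + <-]; rewrite in_itv/= => uL.
      rewrite -[Y u](subrK (Y 0)) addrC (le_trans (ler_normD _ _))// lerD2l.
      exact: Y1.
    have : c * m <= 2^-1 * m by rewrite ler_wpM2r.
    by lra.
  move=> sL; rewrite (le_trans (Y1 _ sL))// -mulrA mulrCA.
  by rewrite ler_wpM2l.
(* The first Picard iterate. The second one, [P3], has derivative [e A P2], so its error is governed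
   by that of [P2]. *)
pose P2 := cst (Y 0) + e \*: (fun s => B s *m Y 0).
have P2E s : P2 s = (1%:M + e *: B s) *m Y 0.
  by rewrite mulmxDl mul1mx -scalemxAl.
have acP2 : absolutely_continuous 0 L P2.
  apply: lipschitz_absolutely_continuous.
  apply: segment_lipschitzD; first exact: segment_lipschitz_cst.
  exact: (segment_lipschitzZ _ (segment_lipschitz_mulmxr _ BK)).
have dP2 x : 0 < x < L -> ~ N1 x -> is_derive x 1 P2 (0 + e *: (A x *m Y 0)).
  move=> xL N1x; exact: (is_deriveD (is_derive_cst _ _ _)
    (is_deriveZ e (is_derive_mulmxr (Y 0) (dB x xL N1x)))).
have Y2 s : 0 <= s <= L -> `|Y s - P2 s| <= 2 * c ^+ 2 * `|Y 0|.
  move=> sL; rewrite (_ : 2 * c ^+ 2 * _ = c * (2 * c * `|Y 0|)); last by ring.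
  have M1 : 0 <= 2 * c * `|Y 0| by rewrite !mulr_ge0.
  have M2 : 0 <= 2 * e * a * (2 * c * `|Y 0|).
    by apply: mulr_ge0 M1; rewrite !mulr_ge0.
  apply: le_trans (sleL _ _ M1 sL).
  apply: (absolutely_continuous_compare M2 acY acP2 (negligibleU N0 N10)
    (df := fun s => e *: (A s *m Y s)) (dg := fun s => 0 + e *: (A s *m Y 0))
    _ _ sL); last by rewrite P2E B0 scaler0 addr0 mul1mx.
  move=> x xL /not_orP[Nx N1x]; split; [exact: dY|exact: dP2|].
  rewrite add0r -scalerBr -mulmxBr; apply: eAY; apply: Y1.
  by case/andP: xL => x0 xL; rewrite !ltW.
pose P3 := P2 + (e ^+ 2) \*: (fun s => D s *m Y 0).
have P3E s : P3 s = (1%:M + e *: B s + e ^+ 2 *: D s) *m Y 0.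
  rewrite [RHS]mulmxDl -P2E -[in RHS]scalemxAl; reflexivity.
have acP3 : absolutely_continuous 0 L P3.
  apply: lipschitz_absolutely_continuous.
  apply: segment_lipschitzD; last first.
    exact: (segment_lipschitzZ _ (segment_lipschitz_mulmxr _ DK)).
  apply: segment_lipschitzD; first exact: segment_lipschitz_cst.
  exact: (segment_lipschitzZ _ (segment_lipschitz_mulmxr _ BK)).
have dP3 x : 0 < x < L -> ~ N1 x -> ~ N2 x -> is_derive x 1 P3
    (0 + e *: (A x *m Y 0) + e ^+ 2 *: ((A x *m B x) *m Y 0)).
  move=> xL N1x N2x; exact: (is_deriveD (dP2 x xL N1x)
    (is_deriveZ (e ^+ 2) (is_derive_mulmxr (Y 0) (dD x xL N2x)))).
rewrite -P3E (_ : 2 * c ^+ 3 * _ = c * (2 * c ^+ 2 * `|Y 0|)); last by ring.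
have M1 : 0 <= 2 * c ^+ 2 * `|Y 0| by rewrite !mulr_ge0// exprn_ge0.
have M2 : 0 <= 2 * e * a * (2 * c ^+ 2 * `|Y 0|).
  by apply: mulr_ge0 M1; rewrite !mulr_ge0.
apply: le_trans (sleL _ _ M1 L0L).
apply: (absolutely_continuous_compare M2 acY acP3
  (negligibleU (negligibleU N0 N10) N20) (df := fun s => e *: (A s *m Y s))
  (dg := fun s => 0 + e *: (A s *m Y 0) + e ^+ 2 *: ((A s *m B s) *m Y 0))
  _ _ L0L); last by rewrite P3E B0 D0 !scaler0 !addr0 mul1mx.
move=> x xL /not_orP[/not_orP[Nx N1x] N2x].
split; [exact: dY|exact: dP3|].
(* Factoring [e A] out of the difference of derivatives leaves [Y - P2], which [Y2] bounds. *)
rewrite add0r expr2 -scalerA -scalerDr -scalerBr -mulmxA scalemxAr -mulmxDr.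
rewrite -mulmxBr; apply: eAY.
rewrite -[Y 0 + _]/(P2 x).
by apply: Y2; case/andP: xL => x0 xL; rewrite !ltW.
Qed.

(** Integration by parts: both sides vanish at [0] and have derivative [A B + B A] almost
    everywhere. *)
Lemma mx_primitive_products s : 0 <= s <= L ->
  D s + mx_int 0 s (fun u => B u *m A u) = B s *m B s.
Proof.
move=> sL; apply/eqP; rewrite -subr_eq0 -normr_le0.
have [N1 N10 dB] := mx_primitive_derive L_ge0 mA (fun t _ => Aa t).
have [N2 N20 dD] := mx_primitive_derive L_ge0 mAB ABa.
have [N3 N30 dC] := mx_primitive_derive L_ge0 mBA BAa.
rewrite -[leRHS](mul0r s).
have acl : absolutely_continuous 0 L
    (D + (fun s => mx_int 0 s (fun u => B u *m A u))).
  apply: lipschitz_absolutely_continuous.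
  exact: (segment_lipschitzD DK (mx_primitive_lipschitz L_ge0 mBA BAa)).
have acr : absolutely_continuous 0 L (fun s => B s *m B s).
  apply: lipschitz_absolutely_continuous.
  exact: (segment_lipschitz_mulmx Ba Ba BK BK).
apply: (absolutely_continuous_compare (lexx 0) acl acr
  (negligibleU (negligibleU N10 N20) N30)
  (df := fun u => A u *m B u + B u *m A u)
  (dg := fun u => A u *m B u + B u *m A u) _ _ sL).
  move=> x xL /not_orP[/not_orP[N1x N2x] N3x]; split.
  - exact: (is_deriveD (dD x xL N2x) (dC x xL N3x)).
  - exact: (is_derive_mulmx (dB x xL N1x) (dB x xL N1x)).
  - by rewrite subrr normr0.
by rewrite !fctE B0 D0 mx_int_point// mulmx0 addr0.
Qed.

End one_period.

(** * The bracket integral as second-order coefficient *)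

Lemma mx_measurable_cst (R : realType) (M : 'M[R]_2) : mx_measurable (cst M).
Proof. by move=> i j; exact: measurable_cst. Qed.

Lemma mx_measurableB (R : realType) (F G : R -> 'M[R]_2) :
  mx_measurable F -> mx_measurable G -> mx_measurable (fun s => F s - G s).
Proof.
move=> mF mG i j.
rewrite /lebesgue_measurable_fun (_ : (fun t => _) =
  (fun t : lebesgueType R => F t i j - G t i j)); last first.
  by apply/funext => t; rewrite !mxE.
by apply: measurable_funB; [exact: mF|exact: mG].
Qed.

Lemma eq_mx_int (R : realType) (a b : R) (F G : R -> 'M[R]_2) :
  (forall s, a <= s <= b -> F s = G s) -> mx_int a b F = mx_int a b G.
Proof.
move=> FG; apply/matrixP => i j; rewrite !mxE; apply: eq_Rintegral => s.
by rewrite inE/= in_itv/= => /FG ->.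
Qed.

Lemma mx_int_trace_eq0 (R : realType) (a b K : R) (F : R -> 'M[R]_2) :
  mx_measurable F -> (forall s, a <= s <= b -> `|F s| <= K) ->
  (forall s, a <= s <= b -> \tr (F s) = 0) -> \tr (mx_int a b F) = 0.
Proof.
move=> mF FK trF; rewrite /mxtrace big_ord_recl big_ord1 !mxE.
set i := ord0; set j := lift _ _; apply/eqP; rewrite addr_eq0; apply/eqP.
rewrite -mulN1r -RintegralZl; last 2 first.
- exact: lebesgue_measurable_itv.
- apply: (@completed_integrable_itv _ _ _ _ K); first exact: mF.
  by move=> s /FK; apply: le_trans; exact: mx_norm_entry.
apply: eq_Rintegral => s; rewrite inE/= in_itv/= => /trF.
rewrite /mxtrace big_ord_recl big_ord1 mulN1r => /eqP.
by rewrite addr_eq0 => /eqP.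
Qed.

Lemma mx_intB (R : realType) (a b K : R) (F G : R -> 'M[R]_2) :
  mx_measurable F -> mx_measurable G ->
  (forall s, a <= s <= b -> `|F s| <= K) ->
  (forall s, a <= s <= b -> `|G s| <= K) ->
  mx_int a b (fun s => F s - G s) = mx_int a b F - mx_int a b G.
Proof.
move=> mF mG FK GK; apply/matrixP => i j; rewrite !mxE.
under eq_Rintegral do rewrite !mxE.
rewrite RintegralB//; first exact: lebesgue_measurable_itv.
- apply: (@completed_integrable_itv _ _ _ _ K); first exact: mF.
  by move=> s /FK; apply: le_trans; exact: mx_norm_entry.
- apply: (@completed_integrable_itv _ _ _ _ K); first exact: mG.
  by move=> s /GK; apply: le_trans; exact: mx_norm_entry.
Qed.

Section Omega2_mean_zero.
Context (R : realType) (A : R -> 'M[R]_2) (L a : R).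
Hypotheses (L_ge0 : 0 <= L) (mA : mx_measurable A) (Aa : forall t, `|A t| <= a).

Let B s := mx_int 0 s A.

Let mB : mx_measurable B.
Proof. exact: mx_primitive_measurable Aa. Qed.

Let a_ge0 : 0 <= a.
Proof. exact: le_trans (normr_ge0 _) (Aa 0). Qed.

Let bracket_norm (M N : 'M[R]_2) c d : `|M| <= c -> `|N| <= d ->
  `|mx_bracket M N| <= 4 * c * d.
Proof.
move=> Mc Nd; rewrite (le_trans (ler_normB _ _))//.
have H (M' N' : 'M[R]_2) c' d' : `|M'| <= c' -> `|N'| <= d' ->
    `|M' *m N'| <= 2 * (c' * d').
  move=> Mc' Nd'; rewrite (le_trans (mx_norm_mulmx _ _))// -mulrA ler_wpM2l//.
  by rewrite ler_pM.
have := H _ _ _ _ Mc Nd; have := H _ _ _ _ Nd Mc; lra.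
Qed.

(** Serves to pull [A s1] out of the inner integral of [Omega2]. Both sides have derivative
    [mx_bracket M (A s)] almost everywhere and vanish at [0]. *)
Lemma mx_int_bracket (M : 'M[R]_2) s : 0 <= s <= L ->
  mx_int 0 s (fun u => mx_bracket M (A u)) = mx_bracket M (B s).
Proof.
move=> sL; apply/eqP; rewrite -subr_eq0 -normr_le0 -[leRHS](mul0r s).
have mMA : mx_measurable (fun u => mx_bracket M (A u)).
  apply: mx_measurableB; apply: mx_measurable_mulmx => //;
  exact: mx_measurable_cst.
have MAa u (_ : 0 <= u <= L) : `|mx_bracket M (A u)| <= 4 * `|M| * a.
  exact: bracket_norm.
have [N1 N10 dB] := mx_primitive_derive L_ge0 mA (fun t _ => Aa t).
have [N2 N20 dD] := mx_primitive_derive L_ge0 mMA MAa.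
have BK := mx_primitive_lipschitz L_ge0 mA (fun t _ => Aa t).
have Ba u (uL : 0 <= u <= L) := mx_primitive_norm L_ge0 mA (fun t _ => Aa t) uL.
apply: (@absolutely_continuous_compare _ _ L 0 (N1 `|` N2)
  (fun s => mx_int 0 s (fun u => mx_bracket M (A u)))
  ((fun s => M *m B s) - (fun s => B s *m M))
  (fun u => mx_bracket M (A u)) (fun u => mx_bracket M (A u))) => //.
- apply: lipschitz_absolutely_continuous.
  exact: (mx_primitive_lipschitz L_ge0 mMA MAa).
- apply: absolutely_continuousB.
    apply: (@lipschitz_absolutely_continuous _ _ _ _ (2 * `|M| * a)) =>
      u v u0 uv vL.
    rewrite -mulmxBr (le_trans (mx_norm_mulmx _ _))//.
    rewrite -[leRHS]mulrA; apply: ler_wpM2l; first by rewrite mulr_ge0.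
    exact: BK.
  apply: lipschitz_absolutely_continuous.
  exact: segment_lipschitz_mulmxr BK.
- exact: negligibleU.
- move=> x xL /not_orP[Nx N1x]; split; first exact: dD.
    by apply: is_deriveB; [apply: is_derive_mulmxl|apply: is_derive_mulmxr];
      exact: dB.
  by rewrite subrr normr0.
- by rewrite !fctE /B !mx_int_point// mulmx0 mul0mx subr0.
Qed.

Let C u := mx_bracket (A u) (B u).

Let mC : mx_measurable C.
Proof. by apply: mx_measurableB; apply: mx_measurable_mulmx. Qed.

Let CK u : 0 <= u <= L -> `|C u| <= 4 * a * (a * L).
Proof.
move=> uL; apply: bracket_norm => //.
rewrite (le_trans (mx_primitive_norm L_ge0 mA (fun t _ => Aa t) uL))//.
by rewrite ler_wpM2l//; case/andP: uL.
Qed.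

Let Omega2E : Omega2 L A = 2^-1 *: mx_int 0 L C.
Proof. by congr (_ *: _); apply: eq_mx_int => s; exact: mx_int_bracket. Qed.

Lemma Omega2_sl2 : sl2 (Omega2 L A).
Proof.
rewrite /sl2/= Omega2E mxtraceZ (@mx_int_trace_eq0 _ _ _ (4 * a * (a * L)))//.
  by rewrite mulr0.
by move=> s _; rewrite raddfB/= mxtrace_mulC subrr.
Qed.

(** Mean zero makes the integrals of [A B] and [B A] opposite, so half the integral of the bracket
    is the plain iterated integral found in [one_period_expansion]. *)
Lemma Omega2_iterated : mx_int 0 L A = 0 ->
  Omega2 L A = mx_int 0 L (fun u => A u *m mx_int 0 u A).
Proof.
move=> A0; have L0L : 0 <= L <= L by rewrite L_ge0 lexx.
have DC := mx_primitive_products L_ge0 mA Aa L0L.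
rewrite A0 mulmx0 in DC.
have BaL u : 0 <= u <= L -> `|B u| <= a * L.
  move=> uL; rewrite (le_trans (mx_primitive_norm L_ge0 mA (fun t _ => Aa t) uL))//.
  by rewrite ler_wpM2l//; case/andP: uL.
have prod_norm (M N : 'M[R]_2) c d : `|M| <= c -> `|N| <= d ->
    `|M *m N| <= 2 * (c * d).
  move=> Mc Nd; rewrite (le_trans (mx_norm_mulmx _ _))// -mulrA ler_wpM2l//.
  by rewrite ler_pM.
rewrite Omega2E (@mx_intB _ _ _ (2 * (a * (a * L)))); first last.
- by move=> u uL; rewrite (mulrC a) prod_norm// BaL.
- by move=> u uL; rewrite prod_norm// BaL.
- exact: mx_measurable_mulmx.
- exact: mx_measurable_mulmx.
move/eqP : DC; rewrite addrC addr_eq0 => /eqP ->.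
rewrite opprK scalerDr -scalerDl (_ : 2^-1 + 2^-1 = 1 :> R) ?scale1r//.
by lra.
Qed.

End Omega2_mean_zero.

(** * The exponential of a trace-free matrix *)

Lemma sum_ord2 (V : nmodType) (F : 'I_2 -> V) : \sum_(k < 2) F k = F 0 + F 1.
Proof. by rewrite big_ord_recl big_ord1; congr (_ + F _); exact/val_inj. Qed.

Lemma forall_ord2 (P : 'I_2 -> Prop) : P 0 -> P 1 -> forall i, P i.
Proof.
move=> P0 P1 [[|[|//]] ?]; [rewrite (_ : Ordinal _ = 0)//|
  rewrite (_ : Ordinal _ = 1)//]; exact: val_inj.
Qed.

Lemma det_mx2 (R : comNzRingType) (X : 'M[R]_2) :
  \det X = X 0 0 * X 1 1 - X 0 1 * X 1 0.
Proof.
rewrite (expand_det_row _ 0) sum_ord2 /cofactor !det_mx11 !mxE /=.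
rewrite expr0 mul1r expr1 mulN1r mulrN.
by congr (_ * X _ _ - _ * X _ _); exact/val_inj.
Qed.

Section sl2_coordinates.
Context (R : comNzRingType) (X : 'M[R]_2).
Hypothesis trX : \tr X = 0.

Let X11 : X 1 1 = - X 0 0.
Proof.
by move: trX; rewrite /mxtrace sum_ord2 addrC => /eqP; rewrite addr_eq0 => /eqP.
Qed.

Lemma mx_sqr_sl2 : X *m X = (- \det X)%:M.
Proof.
apply/matrixP; apply: forall_ord2; apply: forall_ord2;
  by rewrite det_mx2 !mxE sum_ord2 X11 /=; ring.
Qed.

Lemma det_sl2_coordinates a b : \det (a%:M + b *: X) = a ^+ 2 + b ^+ 2 * \det X.
Proof. by rewrite !det_mx2 !mxE X11 /=; ring. Qed.

End sl2_coordinates.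

Lemma eigenvalue_det (F : fieldType) n (g : 'M[F]_n) a :
  eigenvalue g a = (\det (g - a%:M) == 0).
Proof.
by rewrite /eigenvalue /eigenspace kermx_eq0 row_free_unit unitmxE
  unitfE negbK.
Qed.

(* For [X *m X = q%:M], the [k]-th power of [X] is [(coeff k).1 + (coeff k).2 X]. *)
Fixpoint sqr_scalar_coeff (R : pzRingType) (q : R) (k : nat) : R * R :=
  if k is k'.+1 then (q * (sqr_scalar_coeff q k').2, (sqr_scalar_coeff q k').1)
  else (1, 0).

(** For [X *m X = q%:M], the functions with [exp(tX) = c(t) + s(t) X]: they are [cosh(r t)] and
    [sinh(r t) / r] if [q = r^2 > 0], [cos(r t)] and [sin(r t) / r] if [q = - r^2 < 0], [1] and [t]
    if [q = 0]. Collecting their properties confines the case distinction on the sign of [q] to the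
    existence proof. *)
Record exp_coordinates (R : realType) (q : R) (c s : R -> R) : Prop := {
  exp_coord0 : c 0 = 1 /\ s 0 = 0;
  exp_coord_derive :
    is_derive (0 : R) (1 : R) c (0 : R) /\ is_derive (0 : R) (1 : R) s (1 : R);
  exp_coordD : forall t u, c (t + u) = c t * c u + q * (s t * s u) /\
                           s (t + u) = s t * c u + c t * s u;
  exp_coord_det : forall t, c t ^+ 2 - q * s t ^+ 2 = 1;
  exp_coord_bounded : exists G, forall t, `|t| <= 1 -> `|c t| <= G /\ `|s t| <= G;
  exp_coord_gt1 : 0 < q -> 1 < c 1;
  exp_coord_series :
    series (fun k => (sqr_scalar_coeff q k).1 / k`!%:R) @ \oo --> c 1 /\
    series (fun k => (sqr_scalar_coeff q k).2 / k`!%:R) @ \oo --> s 1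
}.

Lemma exp_coordinates0 (R : realType) : exp_coordinates (0 : R) (cst 1) id.
Proof.
split => //.
- by split; [exact: is_derive_cst|exact: is_derive_id].
- by move=> t u; rewrite /= !(mulr1, mul1r, mul0r, addr0).
- by move=> t; rewrite mul0r subr0 expr1n.
- by exists 1 => t; rewrite normr1.
- by rewrite ltxx.
- have c0 k : sqr_scalar_coeff (0 : R) k.+2 = (0, 0) by rewrite /= !mul0r.
  split; apply: cvg_near_cst; exists 2%N => //= -[|[|n]] // _;
    rewrite /series/= 2?big_nat_recl// big1 => [|k _]; rewrite ?c0 ?mul0r//.
    by rewrite /= divr1 !(mulr0, mul0r, addr0).
  by rewrite /= divr1 !(mul0r, add0r, addr0).
Qed.

Lemma exp_coordinates_pos (R : realType) (r : R) : 0 < r ->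
  exp_coordinates (r ^+ 2) (fun t => (expR (r * t) + expR (- r * t)) / 2)
    (fun t => (expR (r * t) - expR (- r * t)) / (2 * r)).
Proof.
move=> r0; have rn0 : r != 0 by rewrite gt_eqF.
have EN t : expR (r * t) * expR (- r * t) = 1.
  by rewrite mulNr -expRD subrr expR0.
have coeffE k : sqr_scalar_coeff (r ^+ 2) k =
    ((r ^+ k + (- r) ^+ k) / 2, (r ^+ k - (- r) ^+ k) / (2 * r)).
  elim: k => [|k /= ->/=]; first by rewrite !expr0; congr pair; field.
  by rewrite !exprS; congr pair; field.
split => /=.
- by rewrite !mulr0 expR0 subrr mul0r; split => //; lra.
- split.
  + by apply: is_derive_eq; rewrite !mulr0 expR0 /GRing.scale/=; ring.
  + by apply: is_derive_eq; rewrite !mulr0 expR0 /GRing.scale/=; field.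
- by move=> t u; rewrite !mulrDr !expRD; split; field.
- move=> t; have := EN t; set x := expR _; set y := expR _ => xy.
  by rewrite -[RHS]xy; field.
- exists (expR r + expR r / r) => t; rewrite ler_norml => /andP[tN1 t1].
  have e1 : expR (r * t) <= expR r by rewrite ler_expR -[leRHS]mulr1 ler_wpM2l// ltW.
  have e2 : expR (- r * t) <= expR r.
    by rewrite ler_expR mulNr -mulrN -[leRHS]mulr1 ler_wpM2l ?(ltW r0)// lerNl.
  have p1 := expR_gt0 (r * t); have p2 := expR_gt0 (- r * t).
  have p : 0 <= expR r / r by rewrite divr_ge0 ?expR_ge0// ltW.
  split.
    by rewrite ger0_norm; [lra|rewrite divr_ge0// addr_ge0// expR_ge0].
  rewrite normrM normfV (gtr0_norm (_ : 0 < 2 * r)) ?mulr_gt0//.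
  rewrite ler_pdivrMr ?mulr_gt0//.
  have -> : (expR r + expR r / r) * (2 * r) = 2 * (r * expR r) + 2 * expR r.
    by field.
  have rE : 0 <= r * expR r by rewrite mulr_ge0 ?expR_ge0// ltW.
  by rewrite ler_norml; apply/andP; split; lra.
- move=> _; rewrite mulr1 mulr1.
  have := EN 1; rewrite !mulr1; have := expR_gt1Dx rn0.
  have := expR_gt0 (- r); set x := expR r; set y := expR (- r) => y0 x1 xy.
  rewrite ltr_pdivlMr// mul1r.
  have x10 : 1 < x by rewrite (le_lt_trans _ x1)// lerDl ltW.
  (* As [x * y = 1], this product equals [x + y - 2]; hence the hyperbolic cosine exceeds [1]. *)
  have : 0 < (x - 1) ^+ 2 * y by rewrite mulr_gt0// exprn_gt0// subr_gt0.
  by rewrite (_ : _ * y = (x * y) * x - 2 * (x * y) + y); [rewrite xy; lra|ring].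
- have cE x : series (exp_coeff x) @ \oo --> expR x := is_cvg_series_exp_coeff x.
  rewrite !mulr1; split.
    rewrite (_ : series _ = (fun n => (series (exp_coeff r) n +
        series (exp_coeff (- r)) n) / 2)).
      by apply: cvgM; [apply: cvgD; exact: cE|exact: cvg_cst].
    apply/funext => n; rewrite /series/= -big_split/= mulr_suml.
    by apply: eq_bigr => k _; rewrite coeffE /exp_coeff/= -mulrDl mulrAC.
  rewrite (_ : series _ = (fun n => (series (exp_coeff r) n -
      series (exp_coeff (- r)) n) / (2 * r))).
    by apply: cvgM; [apply: cvgB; exact: cE|exact: cvg_cst].
  apply/funext => n; rewrite /series/= -sumrB/= mulr_suml.
  by apply: eq_bigr => k _; rewrite coeffE /exp_coeff/= -mulrBl mulrAC.
Qed.

Lemma exp_coordinates_neg (R : realType) (r : R) : 0 < r ->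
  exp_coordinates (- r ^+ 2) (fun t => cos (r * t)) (fun t => sin (r * t) / r).
Proof.
move=> r0; have rn0 : r != 0 by rewrite gt_eqF.
(* The closed form follows the shape of [cos_coeff] and [sin_coeff], so that the two series below
   are literally those of cosine and sine. *)
have coeffE k : sqr_scalar_coeff (- r ^+ 2) k =
    ((~~ odd k)%:R * (-1) ^+ k./2 * r ^+ k,
     (odd k)%:R * (-1) ^+ k.-1./2 * r ^+ k / r).
  elim: k => [|k IHk]; first by rewrite /= !expr0; congr pair; rewrite ?mul0r ?mulr1.
  rewrite [LHS]/= IHk /=; congr pair; last first.
    by rewrite exprSr mulrA mulfK.
  rewrite negbK; case: (boolP (odd k)) => ok; last by rewrite /= !mul0r mulr0.
  case: k ok {IHk} => // k; rewrite /= => ok.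
  by rewrite !mul1r !exprS; field.
split => /=.
- by rewrite mulr0 cos0 sin0 mul0r.
- split.
  + by apply: is_derive_eq; rewrite !mulr0 sin0 /GRing.scale/=; ring.
  + by apply: is_derive_eq; rewrite !mulr0 cos0 /GRing.scale/=; field.
- by move=> t u; rewrite !mulrDr sinD cosD; split; field.
- move=> t; rewrite -[RHS](cos2Dsin2 (r * t)); field; exact: rn0.
- exists (1 + r^-1) => t _; have ri : 0 <= r^-1 by rewrite invr_ge0 ltW.
  split; first by rewrite (le_trans (cos_max _))// lerDl.
  rewrite normrM (ger0_norm ri) (@le_trans _ _ (1 * r^-1))//.
    by rewrite ler_wpM2r// sin_max.
  by rewrite mul1r lerDr.
- by rewrite oppr_gt0 ltNge sqr_ge0.
- rewrite mulr1; split.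
    rewrite (_ : series _ = series (cos_coeff r)).
      by rewrite unlock; exact: is_cvg_series_cos_coeff.
    by congr series; apply/funext => k; rewrite coeffE /cos_coeff.
  rewrite (_ : series _ = fun n => series (sin_coeff r) n / r).
    apply: cvgM; last exact: cvg_cst.
    by rewrite unlock; exact: is_cvg_series_sin_coeff.
  apply/funext => n; rewrite /series/= mulr_suml; apply: eq_bigr => k _.
  by rewrite coeffE /sin_coeff/= mulrAC.
Qed.

Lemma exp_coordinates_exist (R : realType) (q : R) :
  exists c s, exp_coordinates q c s.
Proof.
have [q0|q0|->] := ltgtP q 0; last by do 2 eexists; exact: exp_coordinates0.
- have r0 : 0 < Num.sqrt (- q) by rewrite sqrtr_gt0 oppr_gt0.
  do 2 eexists; have := exp_coordinates_neg r0.
  by rewrite sqr_sqrtr ?oppr_ge0 ?(ltW q0)// opprK; exact.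
- have r0 : 0 < Num.sqrt q by rewrite sqrtr_gt0.
  do 2 eexists; have := exp_coordinates_pos r0.
  by rewrite sqr_sqrtr ?(ltW q0)//; exact.
Qed.

(** * Approximate products compared with the exponential flow *)

Lemma mx_norm_scalar2 (R : realType) (a : R) : `|(a%:M : 'M[R]_2)| <= `|a|.
Proof.
apply/mx_norm_leP => // i j; rewrite mxE; case: (i == j); first by rewrite mulr1n.
by rewrite mulr0n normr0.
Qed.

Section exp_flow.
Context (R : realType) (X : 'M[R]_2) (q : R) (c s : R -> R).
Hypotheses (Xq : X *m X = q%:M) (cs : exp_coordinates q c s).

Let E t : 'M[R]_2 := (c t)%:M + s t *: X.

Let ED t u : E (t + u) = E t *m E u.
Proof.
have [cD sD] := exp_coordD cs t u.
rewrite /E cD sD mulmxDl !mulmxDr mul_scalar_mx mul_scalar_mx mul_mx_scalar.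
rewrite -scalemxAl -scalemxAr Xq; apply/matrixP => i j; rewrite !mxE.
by case: (i == j); rewrite ?mulr1n ?mulr0n; ring.
Qed.

Let E0 : E 0 = 1%:M.
Proof. by have [c0 s0] := exp_coord0 cs; rewrite /E c0 s0 scale0r addr0. Qed.

Lemma mx_exp_coordinates : mx_exp X = E 1.
Proof.
have XkE k : X ^+ k = (sqr_scalar_coeff q k).1%:M + (sqr_scalar_coeff q k).2 *: X.
  elim: k => [|k IHk]; first by rewrite expr0 scale0r addr0.
  rewrite exprS IHk /= -mulmxE mulmxDr mul_mx_scalar -scalemxAr Xq.
  by rewrite scale_scalar_mx mulrC addrC.
have [cE sE] := exp_coord_series cs.
apply: cvg_lim; first exact: norm_hausdorff.
rewrite (_ : series _ = (fun n =>
    (series (fun k => (sqr_scalar_coeff q k).1 / k`!%:R) n) *: 1%:M +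
    (series (fun k => (sqr_scalar_coeff q k).2 / k`!%:R) n) *: X)).
  by rewrite /E -[(c 1)%:M]scalemx1; exact: (cvgD (cvgZr_tmp cE) (cvgZr_tmp sE)).
apply/funext => n; rewrite /series/= !scaler_suml -big_split/=.
apply: eq_bigr => k _; rewrite XkE scalerDr !scale_scalar_mx !scalerA.
by congr (_%:M + _ *: X); rewrite ?mulr1 mulrC.
Qed.

Let E_bounded : exists2 G, 0 <= G & forall t, `|t| <= 1 -> `|E t| <= G.
Proof.
have [G HG] := exp_coord_bounded cs.
have G0 : 0 <= G.
  have /HG[cG _] : `|0 : R| <= 1 by rewrite normr0.
  exact: le_trans (normr_ge0 _) cG.
exists (G + G * `|X|); first by rewrite addr_ge0// mulr_ge0.
move=> t /HG[cG sG]; rewrite (le_trans (ler_normD _ _))// lerD//.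
  exact: le_trans (mx_norm_scalar2 _) cG.
by rewrite normrZ ler_wpM2r.
Qed.

Let E_expansion e : 0 < e -> exists2 d : R, 0 < d &
  forall h, `|h| < d -> `|E h - (1%:M + h *: X)| <= e * `|h|.
Proof.
move=> e0; have [c0 s0] := exp_coord0 cs; have [dc ds] := exp_coord_derive cs.
pose e' := e / (1 + `|X|); have X1 : 0 < 1 + `|X| by rewrite ltr_wpDr.
have e'0 : 0 < e' by rewrite divr_gt0.
have [d1 d10 H1] := is_derive_increment e'0 dc.
(* Subtracting the linear part leaves derivative [0], so the increment bound becomes
   [|s h - h| <= e' |h|]. *)
have ds' : is_derive (0 : R) (1 : R) (s - id) (0 : R).
  by apply: is_derive_eq; rewrite subrr.
have [d2 d20 H2] := is_derive_increment e'0 ds'.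
exists (Num.min d1 d2); first by rewrite lt_min d10.
move=> h; rewrite lt_min => /andP[hd1 hd2].
have := H1 h; rewrite subr0 => /(_ hd1); rewrite c0 normr0 add0r => Hc.
have := H2 h; rewrite subr0 => /(_ hd2).
rewrite !fctE s0 subrr subr0 normr0 add0r => Hs.
have -> : E h - (1%:M + h *: X) = (c h - 1)%:M + (s h - h) *: X.
  by rewrite raddfB/= scalerBl opprD addrACA.
rewrite (le_trans (ler_normD _ _))// normrZ.
rewrite (le_trans (lerD (le_trans (mx_norm_scalar2 _) Hc)
  (ler_wpM2r (normr_ge0 X) Hs)))//.
by rewrite /e' le_eqVlt; apply/orP; left; apply/eqP; field; rewrite gt_eqF.
Qed.

(* Undoing the flow, [w k = E (- k / N) z_k] satisfies the discrete Gronwall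
   bound [|w k.+1 - w k| <= kappa |w k|] with [N * kappa] tending to [0]. *)
Lemma exp_flow_discrete (z : nat -> nat -> 'M[R]_2) (eta : nat -> R) :
  (\forall N \near \oo, z N 0 = 1%:M /\ forall k, (k < N)%N ->
     `|z N k.+1 - (1%:M + N%:R^-1 *: X) *m z N k| <= eta N * `|z N k|) ->
  N%:R * eta N @[N --> \oo] --> (0 : R) ->
  z N N @[N --> \oo] --> E 1.
Proof.
move=> zH eta0; have [G G0 EG] := E_bounded.
pose delta N := `|E N%:R^-1 - (1%:M + N%:R^-1 *: X)|.
have delta0 N : 0 <= delta N by exact: normr_ge0.
(* The local defect is [eta] against the Euler step plus [2 delta] between the Euler step and the
   flow. Conjugating by the flow costs a factor [2 G] for multiplying by [E (- t)] and another for
   bounding [z] by [w]. *)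
pose kappa N := 4 * G ^+ 2 * (`|eta N| + 2 * delta N).
have Ndelta : N%:R * delta N @[N --> \oo] --> (0 : R).
  apply/cvgrPdist_le => e e0; have [d d0 Hd] := E_expansion e0.
  near=> N; have N0 : (0 < N)%N by near: N; exact: nbhs_infty_gt.
  rewrite sub0r normrN ger0_norm ?mulr_ge0// mulrC -ler_pdivlMr ?ltr0n//.
  rewrite (le_trans (Hd _ _))//; last by rewrite ger0_norm// invr_ge0.
  rewrite ger0_norm ?invr_ge0// invf_plt ?posrE ?ltr0n//.
  by near: N; exact: nbhs_infty_gtr.
have Nkappa : N%:R * kappa N @[N --> \oo] --> (0 : R).
  rewrite (_ : (fun N => _) = fun N => 4 * G ^+ 2 *
      (`|N%:R * eta N| + 2 * (N%:R * delta N))); last first.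
    by apply/funext => N; rewrite /kappa normrM normr_nat; ring.
  rewrite -(mulr0 (4 * G ^+ 2)) -(addr0 0) -[X in X + _](@normr0 R R).
  rewrite -[X in _ + X](mulr0 2); apply: cvgMl_tmp; apply: cvgD.
    exact: cvg_norm.
  exact: cvgMl_tmp.
have fcvg : 2 * G * (expR (N%:R * kappa N) - 1) @[N --> \oo] --> (0 : R).
  rewrite -(mulr0 (2 * G)) -(subrr 1) -[X in X - _](@expR0 R).
  apply: cvgMl_tmp; apply: cvgB; last exact: cvg_cst.
  by apply: continuous_cvg => //; exact: continuous_expR.
apply/cvgrPdist_le => e e0.
move/cvgrPdist_le : fcvg => /(_ e e0) fe.
near=> N.
have [z0 zS] : z N 0 = 1%:M /\ forall k, (k < N)%N ->
  `|z N k.+1 - (1%:M + N%:R^-1 *: X) *m z N k| <= eta N * `|z N k| by near: N.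
have N0 : (0 < N)%N by near: N; exact: nbhs_infty_gt.
have Ne : `|0 - 2 * G * (expR (N%:R * kappa N) - 1)| <= e by near: N.
have kappa0 : 0 <= kappa N.
  by rewrite !mulr_ge0 ?exprn_ge0// addr_ge0// mulr_ge0.
have tN k : (k <= N)%N -> `|k%:R / N%:R : R| <= 1.
  move=> kN; rewrite ger0_norm ?divr_ge0// ler_pdivrMr ?ltr0n// mul1r.
  by rewrite ler_nat.
pose w k := E (- (k%:R / N%:R)) *m z N k.
have zw k : z N k = E (k%:R / N%:R) *m w k.
  by rewrite mulmxA -ED subrr E0 mul1mx.
have wS k : (k < N)%N -> `|w k.+1 - w k| <= kappa N * `|w k|.
  move=> kN.
  (* By the group law [E (- k / N)] is [E (- (k + 1) / N)] times [E (1 / N)], which exposes the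
     defect of [z] against the exact flow. *)
  have -> : w k.+1 - w k =
      E (- (k.+1%:R / N%:R)) *m (z N k.+1 - E N%:R^-1 *m z N k).
    rewrite mulmxBr mulmxA -ED; congr (_ - E _ *m _).
    by rewrite -natr1 mulrDl mul1r opprD subrK.
  rewrite (le_trans (mx_norm_mulmx _ _))//.
  have zk : `|z N k| <= 2 * G * `|w k|.
    rewrite zw (le_trans (mx_norm_mulmx _ _))// ler_wpM2r// ler_wpM2l//.
    by rewrite EG// tN// ltnW.
  have step : `|z N k.+1 - E N%:R^-1 *m z N k| <=
      (`|eta N| + 2 * delta N) * `|z N k|.
    have -> : z N k.+1 - E N%:R^-1 *m z N k =
        (z N k.+1 - (1%:M + N%:R^-1 *: X) *m z N k) -
        (E N%:R^-1 - (1%:M + N%:R^-1 *: X)) *m z N k.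
      by rewrite mulmxBl opprB addrA subrK.
    rewrite (le_trans (ler_normB _ _))// mulrDl lerD//.
      by rewrite (le_trans (zS _ kN))// ler_wpM2r// ler_norm.
    exact: mx_norm_mulmx.
  have EkG : `|E (- (k.+1%:R / N%:R))| <= G by rewrite EG// normrN tN.
  have d0 : 0 <= `|eta N| + 2 * delta N by rewrite addr_ge0// mulr_ge0.
  rewrite (le_trans (ler_pM _ _ (ler_wpM2l _ EkG)
    (le_trans step (ler_wpM2l d0 zk))))// ?mulr_ge0//.
  by rewrite /kappa le_eqVlt; apply/orP; left; apply/eqP; ring.
have w0 : w 0%N = 1%:M by rewrite /w mul0r oppr0 E0 mul1mx z0.
(* The second bound needs the first: the increments [kappa (1 + kappa)^k] telescope to
   [(1 + kappa)^k - 1]. *)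
have wB k : (k <= N)%N ->
    `|w k| <= (1 + kappa N) ^+ k /\ `|w k - 1%:M| <= (1 + kappa N) ^+ k - 1.
  elim: k => [_|k IHk kN].
    rewrite w0 expr0 !subrr normr0 lexx; split => //.
    by rewrite (le_trans (mx_norm_scalar2 _))// normr1.
  have [IH1 IH2] := IHk (ltnW kN); have := wS k kN => H.
  have H' : kappa N * `|w k| <= kappa N * (1 + kappa N) ^+ k by rewrite ler_wpM2l.
  split.
    rewrite -[w k.+1](subrK (w k)) (le_trans (ler_normD _ _))//.
    by rewrite exprS mulrDl mul1r addrC lerD// (le_trans H).
  rewrite -[w k.+1](subrK (w k)) -addrA (le_trans (ler_normD _ _))//.
  by rewrite exprS mulrDl mul1r [leRHS]addrAC [leRHS]addrC lerD// (le_trans H).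
have [_ wN] := wB N (leqnn N).
have -> : E 1 - z N N = E 1 *m (1%:M - w N).
  by rewrite [z N N]zw divff ?pnatr_eq0 -?lt0n// mulmxBr mulmx1.
rewrite (le_trans (mx_norm_mulmx _ _))// distrC.
move: Ne; rewrite sub0r normrN => /(le_trans (ler_norm _)); apply: le_trans.
apply: ler_pM; rewrite ?mulr_ge0//.
  by rewrite ler_wpM2l// EG// normr1.
(* [(1 + kappa N) ^+ N] is at most [expR (N%:R * kappa N)], which tends to [1]. *)
rewrite (le_trans wN)// lerD2r mulrC expRM_natr.
rewrite lerXn2r ?nnegrE ?addr_ge0 ?expR_ge0//.
exact: expR_ge1Dx.
Unshelve. all: by end_near. Qed.

End exp_flow.

(** * Hyperbolicity read off the determinant *)

Lemma mx_exp_hyperbolic (R : realType) (X : 'M[R]_2) : \tr X = 0 ->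
  hyperbolic (mx_exp X) <-> \det X < 0.
Proof.
move=> trX; have [c [s cs]] := exp_coordinates_exist (- \det X).
rewrite (mx_exp_coordinates (mx_sqr_sl2 trX) cs).
have cs1 := exp_coord_det cs 1; have c1 := exp_coord_gt1 cs.
move: cs1 c1; set x := c 1; set y := s 1 => xy x1.
have eigE l : eigenvalue (x%:M + y *: X) l = ((x - l) ^+ 2 + y ^+ 2 * \det X == 0).
  rewrite eigenvalue_det -(det_sl2_coordinates trX) raddfB/= addrAC.
  by [].
split=> [[_ [l [m [+ + l1 m1]]]]|X0].
  rewrite !eigE ltNge => /eqP lE /eqP mE; apply/negP => X0.
  have yX : 0 <= y ^+ 2 * \det X by rewrite mulr_ge0// sqr_ge0.
  (* When [\det X >= 0] the characteristic polynomial is a sum of two nonnegative terms, so every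
     real eigenvalue equals [x] and two distinct moduli are impossible. *)
  have sqr0 v : (x - v) ^+ 2 + y ^+ 2 * \det X = 0 -> v = x.
    move=> /eqP; rewrite paddr_eq0 ?sqr_ge0// sqrf_eq0 subr_eq0.
    by move=> /andP[/eqP ->].
  by move: l1; rewrite (sqr0 _ lE) -(sqr0 _ mE) ltNge ltW.
have {}x1 : 1 < x by apply: x1; rewrite oppr_gt0.
split; first by rewrite (det_sl2_coordinates trX) -[RHS]xy; ring.
have w0 : 0 <= x ^+ 2 - 1 by nra.
have wE := sqr_sqrtr w0; have := sqrtr_ge0 (x ^+ 2 - 1).
set w := Num.sqrt _ => w_ge0.
have yE : y ^+ 2 * \det X = - w ^+ 2 by rewrite wE; lra.
(* For [x > 1] one has [(x - 1)^2 < x^2 - 1 < x^2], so [w] lies between [x - 1] and [x]; this puts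
   the eigenvalue [x - w] in []0, 1[]. *)
have xw : x - 1 < w by rewrite ltNge; apply/negP; nra.
have wx : w < x by rewrite ltNge; apply/negP; nra.
exists (x + w), (x - w); split.
- by rewrite eigE yE; apply/eqP; ring.
- by rewrite eigE yE; apply/eqP; ring.
- by rewrite ger0_norm; lra.
- by rewrite ltr_norml; apply/andP; split; lra.
Qed.

(** * Convergence of the return map *)

Lemma absolutely_continuous_affine (R : realType) (V : normedModType R)
    (a b a' b' c r : R) (f : R -> V) : 0 < r -> a <= c + r * a' ->
  c + r * b' <= b -> absolutely_continuous a b f ->
  absolutely_continuous a' b' (fun s => f (c + r * s)).
Proof.
move=> r0 aa bb acf e /acf[d d0 fd]; exists (d / r); first exact: divr_gt0.
move=> n u v uv tr; rewrite ltr_pdivlMr// => uvd.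
apply: (fd n (fun k => c + r * u k) (fun k => c + r * v k)).
- move=> k; have [au [ukv vb]] := uv k; rewrite lerD2l ler_pM2l// ukv.
  split; first by rewrite (le_trans aa)// lerD2l ler_pM2l.
  by split => //; rewrite (le_trans _ bb)// lerD2l ler_pM2l.
- move=> i j _ _ [x [/=]]; rewrite !in_itv/= => xi xj; apply: tr => //.
  exists ((x - c) / r); split; rewrite /= in_itv/= ltr_pdivlMr// ltr_pdivrMr//;
  by rewrite ltrBlDl ltrBrDl ![_ * r]mulrC.
- rewrite (eq_bigr (fun k => (v k - u k) * r)) -?mulr_suml// => k _.
  by rewrite opprD addrACA subrr add0r -mulrBr mulrC.
Qed.

Lemma is_derive_mx_affine (R : realType) m n (F : R -> 'M[R]_(m, n)) dF
    (c r s : R) : is_derive (c + r * s) 1 F dF ->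
  is_derive s 1 (fun u => F (c + r * u)) (r *: dF).
Proof.
move=> /is_derive_mxP dF_; apply/is_derive_mxP => i j; rewrite mxE.
have daff : is_derive s 1 (fun u => c + r * u) r.
  by apply: is_derive_eq; rewrite /GRing.scale/=; ring.
rewrite [r * _]mulrC.
exact: (@is_derive1_comp _ (fun u => F u i j) (fun u => c + r * u) _ _ _ (dF_ i j)).
Qed.

(** [p] stands for [1 - alpha]. The period starting at [c = k T / N] is pulled back to [[0, L]] by
    [t = c + r s], its length being [r L = T / N], and [one_period_expansion] applies. *)
Lemma fundamental_solution_step (R : realType) (L T a p : R)
    (A : R -> 'M[R]_2) (N k : nat) (Z : R -> 'M[R]_2) :
  0 < L -> 0 < T -> mx_measurable A -> (forall t, `|A t| <= a) ->
  periodic A L -> mx_int 0 L A = 0 -> (k < N)%N ->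
  fundamental_solution T (C_rho (1 - p) A (rho L T N)) Z ->
  let e := rho L T N `^ p in 2 * e * a * L <= 2^-1 ->
  `|Z (k.+1%:R * (T / N%:R)) - (1%:M + e ^+ 2 *: Omega2 L A) *m Z (k%:R * (T / N%:R))|
    <= 2 * (2 * e * a * L) ^+ 3 * `|Z (k%:R * (T / N%:R))|.
Proof.
move=> L0 T0 mA Aa perA A0 kN [acZ _ dZ] e ea.
have N0 : 0 < N%:R :> R by rewrite ltr0n (leq_ltn_trans _ kN).
set r := rho L T N in dZ e ea *.
have r0 : 0 < r by rewrite divr_gt0// mulr_gt0.
have rL : r * L = T / N%:R by rewrite /r /rho; field; rewrite !gt_eqF.
pose c := k%:R * (T / N%:R); pose Y s := Z (c + r * s).
have c0 : 0 <= c by rewrite mulr_ge0// divr_ge0// ltW.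
have cL : c + r * L = k.+1%:R * (T / N%:R) by rewrite rL -natr1 mulrDl mul1r.
have cT : c + r * L <= T.
  rewrite cL mulrCA -[leRHS]mulr1 ler_wpM2l ?(ltW T0)// ler_pdivrMr// mul1r.
  by rewrite ler_nat.
have acY : absolutely_continuous 0 L Y.
  have c0' : 0 <= c + r * 0 by rewrite mulr0 addr0.
  exact: (absolutely_continuous_affine r0 c0' cT acZ).
have [M [mM M0 MZ]] := dZ.
have nM : (@lebesgue_measure R).-negligible M.
  by apply/completed_negligible; exists M; split.
have dY s : 0 < s < L -> ~ M (c + r * s) ->
    is_derive s 1 Y (e *: (A s *m Y s)).
  move=> /andP[s0 sL] Ms.
  have cs : 0 < c + r * s < T.
    apply/andP; split; first by rewrite ltr_wpDl// mulr_gt0.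
    by rewrite (lt_le_trans _ cT)// ltrD2l ltr_pM2l.
  have /is_derive_mx_affine : is_derive (c + r * s) 1 Z
      (C_rho (1 - p) A r (c + r * s) *m Z (c + r * s)).
    by apply: contrapT => h; apply: Ms; apply: MZ => /= /(_ cs).
  rewrite /C_rho -scalemxAl scalerA.
  have -> : A ((c + r * s) / r) = A s.
    (* Divided by [r], the starting time [c] is [k] whole periods. *)
    rewrite (_ : (c + r * s) / r = s + L *+ k) ?periodicn//.
    by rewrite /c -rL -[L *+ k]mulr_natl; field; rewrite gt_eqF.
  (* The chain rule contributes [r], the amplitude [r^(-alpha)]; together they are [r^p]. *)
  rewrite (_ : r * r `^ (- (1 - p)) = e)//.
  rewrite -{1}[r]powRr1 ?(ltW r0)// -powRD; last first.
    by rewrite (gt_eqF r0) implybT.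
  by congr (_ `^ _); ring.
have := one_period_expansion (ltW L0) mA Aa (powR_ge0 _ _) acY
  (negligible_affine_preimage c r0 nM) dY ea.
rewrite A0 scaler0 addr0 -(Omega2_iterated (ltW L0) mA Aa A0).
by rewrite /Y mulr0 addr0 cL.
Qed.

Lemma powR_cvg0 (R : realType) (u : nat -> R) (p : R) : 0 < p ->
  (forall n, 0 <= u n) -> u n @[n --> \oo] --> (0 : R) ->
  u n `^ p @[n --> \oo] --> (0 : R).
Proof.
move=> p0 u0 /cvgrPdist_le ucvg; apply/cvgrPdist_le => e e0.
have := ucvg _ (powR_gt0 p^-1 e0); apply: filterS => n.
rewrite !sub0r !normrN !ger0_norm ?powR_ge0// => une.
rewrite (le_trans (ge0_ler_powR (ltW p0) _ _ une)) ?nnegrE ?powR_ge0//.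
by rewrite -powRrM mulVf ?gt_eqF// powRr1// ltW.
Qed.

Lemma rho_cvg0 (R : realType) (L T : R) : 0 < L -> 0 < T ->
  rho L T N @[N --> \oo] --> (0 : R).
Proof.
move=> L0 T0; apply/cvgrPdist_le => e e0; near=> N.
have N0 : (0 < N)%N by near: N; exact: nbhs_infty_gt.
rewrite sub0r normrN ger0_norm; last by rewrite divr_ge0 ?mulr_ge0// ltW.
rewrite /rho ler_pdivrMr ?mulr_gt0 ?ltr0n// mulrCA -ler_pdivrMr ?mulr_gt0//.
by apply: ltW; near: N; exact: nbhs_infty_gtr.
Unshelve. all: by end_near. Qed.

Section return_map_limit.
Context (R : realType) (L T a p : R) (A : R -> 'M[R]_2) (Z : nat -> R -> 'M[R]_2).
Hypotheses (L_gt0 : 0 < L) (T_gt0 : 0 < T) (mA : mx_measurable A)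
  (Aa : forall t, `|A t| <= a) (perA : periodic A L) (A0 : mx_int 0 L A = 0)
  (HZ : forall N, (0 < N)%N ->
    fundamental_solution T (C_rho (1 - p) A (rho L T N)) (Z N)).

Let e N := rho L T N `^ p.

Let e_cvg0 : 0 < p -> e N @[N --> \oo] --> (0 : R).
Proof.
move=> p0; apply: powR_cvg0 => //; last exact: rho_cvg0.
by move=> N; rewrite divr_ge0 ?mulr_ge0// ltW.
Qed.

(** As [e N] tends to [0], the smallness condition of the one-period estimate holds from some [N]
    on, uniformly in [k]. *)
Let near_step : 0 < p -> \forall N \near \oo, forall k, (k < N)%N ->
  `|Z N (k.+1%:R * (T / N%:R)) -
      (1%:M + e N ^+ 2 *: Omega2 L A) *m Z N (k%:R * (T / N%:R))|
    <= 2 * (2 * e N * a * L) ^+ 3 * `|Z N (k%:R * (T / N%:R))|.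
Proof.
move=> p0; have eaL : 2 * e N * a * L @[N --> \oo] --> (0 : R).
  rewrite -[X in _ --> X](mulr0 (2 * a * L)).
  rewrite (_ : (fun N => _) = fun N => 2 * a * L * e N).
    by apply: cvgMl_tmp; exact: e_cvg0.
  by apply/funext => N; ring.
have h : (0 : R) < 2^-1 by rewrite invr_gt0.
move/cvgrPdist_le : eaL => /(_ _ h); apply: filterS => N eaN k kN.
apply: fundamental_solution_step => //.
  by apply: HZ; rewrite (leq_ltn_trans _ kN).
by move: eaN; rewrite sub0r normrN; exact/le_trans/ler_norm.
Qed.

Let Z0 : \forall N \near \oo, Z N (0%:R * (T / N%:R)) = 1%:M.
Proof.
near=> N; have N0 : (0 < N)%N by near: N; exact: nbhs_infty_gt.
by rewrite mul0r; case: (HZ N0).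
Unshelve. all: by end_near. Qed.

Let ZT N : (0 < N)%N -> Z N (N%:R * (T / N%:R)) = Z N T.
Proof.
by move=> N0; rewrite mulrCA divff ?mulr1// pnatr_eq0 -lt0n.
Qed.

Let Nrho N : (0 < N)%N -> N%:R * rho L T N = T / L.
Proof.
by move=> N0; rewrite /rho; field; rewrite gt_eqF// pnatr_eq0 -lt0n.
Qed.

Let Ne2E N : 2^-1 < p -> N%:R * e N ^+ 2 = T / L * rho L T N `^ (2 * p - 1).
Proof.
move=> p12; have p0 : p != 0 by rewrite gt_eqF//; lra.
have p1 : 2 * p - 1 != 0 by rewrite gt_eqF//; lra.
(* At [N = 0] division by zero gives [rho = 0], whose power with nonzero exponent is [0], so the
   identity still holds. *)
have [->|] := posnP N.
  by rewrite mul0r /rho mul0r invr0 mulr0 powR0// mulr0.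
move=> N0; rewrite -(Nrho N0) -mulrA; congr (_ * _).
have r0 : 0 < rho L T N by rewrite divr_gt0// mulr_gt0// ltr0n.
rewrite -{1}[rho L T N]powRr1 ?(ltW r0)// -powRD ?(gt_eqF r0) ?implybT//.
rewrite expr2 -powRD ?(gt_eqF r0) ?implybT//.
by congr (_ `^ _); ring.
Qed.

Let Ne2_cvg0 : 2^-1 < p -> N%:R * e N ^+ 2 @[N --> \oo] --> (0 : R).
Proof.
move=> p12.
rewrite (_ : (fun N => _) = fun N => T / L * rho L T N `^ (2 * p - 1)); last first.
  by apply/funext => N; exact: Ne2E.
rewrite -[X in _ --> X](mulr0 (T / L)); apply: cvgMl_tmp; apply: powR_cvg0.
- by lra.
- by move=> N; rewrite divr_ge0 ?mulr_ge0// ltW.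
- exact: rho_cvg0.
Qed.

Let ZT_cvg (W : 'M[R]_2) :
  Z N (N%:R * (T / N%:R)) @[N --> \oo] --> W -> Z N T @[N --> \oo] --> W.
Proof.
apply: cvg_trans; apply: near_eq_cvg; near=> N; rewrite ZT//.
by near: N; exact: nbhs_infty_gt.
Unshelve. all: by end_near. Qed.

Lemma return_map_cvg1 : 2^-1 < p -> Z N T @[N --> \oo] --> (1%:M : 'M[R]_2).
Proof.
move=> p12; have p0 : 0 < p by lra.
apply: ZT_cvg.
(* The comparison flow is that of [X = 0], constantly the identity, and [eta] takes in the [Omega2]
   term. *)
have XX : (0 : 'M[R]_2) *m 0 = 0%:M by rewrite mul0mx raddf0.
pose eta N := 2 * e N ^+ 2 * `|Omega2 L A| + 2 * (2 * e N * a * L) ^+ 3.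
have := @exp_flow_discrete _ _ _ _ _ XX (exp_coordinates0 R)
  (fun N k => Z N (k%:R * (T / N%:R))) eta.
rewrite scaler0 addr0; apply.
- near=> N; split; first by near: N; exact: Z0.
  move=> k kN; rewrite scaler0 addr0 mul1mx.
  set z := Z N (k%:R * _); set z' := Z N _.
  have -> : z' - z = (z' - (1%:M + e N ^+ 2 *: Omega2 L A) *m z) +
      (e N ^+ 2 *: Omega2 L A) *m z.
    by rewrite mulmxDl mul1mx opprD addrA addrNK.
  rewrite /eta addrC mulrDl (le_trans (ler_normD _ _))// lerD//.
    rewrite -scalemxAl normrZ ger0_norm ?sqr_ge0//.
    rewrite [leRHS](_ : _ = e N ^+ 2 * (2 * `|Omega2 L A| * `|z|)); last by ring.
    by rewrite ler_wpM2l ?sqr_ge0// mx_norm_mulmx.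
  by move: k kN @z @z'; near: N; exact: near_step.
(* Both parts of [N * eta N] carry the factor [N e^2], which tends to [0]; the constant [16] is
   [2 * 2^3]. *)
- rewrite (_ : (fun N => _) = fun N => 2 * `|Omega2 L A| * (N%:R * e N ^+ 2) +
      16 * a ^+ 3 * L ^+ 3 * ((N%:R * e N ^+ 2) * e N)); last first.
    by apply/funext => N; rewrite /eta; ring.
  have N2 := Ne2_cvg0 p12.
  have N3 : N%:R * e N ^+ 2 * e N @[N --> \oo] --> (0 * 0 : R).
    exact: cvgM N2 (e_cvg0 p0).
  have : 2 * `|Omega2 L A| * (N%:R * e N ^+ 2) +
      16 * a ^+ 3 * L ^+ 3 * (N%:R * e N ^+ 2 * e N) @[N --> \oo] -->
      2 * `|Omega2 L A| * 0 + 16 * a ^+ 3 * L ^+ 3 * (0 * 0).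
    by apply: cvgD; exact: cvgMl_tmp.
  by rewrite !mulr0 addr0.
Unshelve. all: by end_near. Qed.

Lemma return_map_cvg_exp : p = 2^-1 ->
  Z N T @[N --> \oo] --> mx_exp ((T / L) *: Omega2 L A).
Proof.
move=> pE; have p0 : 0 < p by rewrite pE invr_gt0.
apply: ZT_cvg; set X := _ *: _.
have trX : \tr X = 0 by rewrite mxtraceZ (Omega2_sl2 (ltW L_gt0) mA Aa) mulr0.
have [c [s cs]] := exp_coordinates_exist (- \det X).
have e2 N : e N ^+ 2 = rho L T N.
  rewrite /e pE powR12_sqrt ?sqr_sqrtr// divr_ge0 ?mulr_ge0// ltW//.
rewrite (mx_exp_coordinates (mx_sqr_sl2 trX) cs).
apply: (@exp_flow_discrete _ _ _ _ _ (mx_sqr_sl2 trX) cs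
  (fun N k => Z N (k%:R * (T / N%:R))) (fun N => 2 * (2 * e N * a * L) ^+ 3)).
- near=> N; split; first by near: N; exact: Z0.
  have N0 : (0 < N)%N by near: N; exact: nbhs_infty_gt.
  (* Since [e^2 = rho = (T / L) / N], one period is an Euler step of size [1 / N] for [X]. *)
  have -> : N%:R^-1 *: X = e N ^+ 2 *: Omega2 L A.
    rewrite scalerA e2 -(Nrho N0) mulKf// pnatr_eq0 -lt0n//.
  by near: N; exact: near_step.
(* Here [N e^2 = T / L], so the accumulated cubic error is a constant times [e N]; one power of [L]
   cancels. *)
- rewrite (_ : (fun N => _) = fun N => 16 * a ^+ 3 * L ^+ 2 * T * e N).
    by rewrite -[X in _ --> X](mulr0 (16 * a ^+ 3 * L ^+ 2 * T));
      apply: cvgMl_tmp; exact: e_cvg0.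
  apply/funext => N; rewrite (_ : 2 * _ ^+ 3 = 16 * a ^+ 3 * L ^+ 3 * (e N ^+ 2 * e N)).
    rewrite e2; have [->|N0] := posnP N.
      by rewrite /e /rho !mul0r invr0 mulr0 powR0 ?gt_eqF// mulr0.
    by rewrite mulrCA [N%:R * _]mulrA (Nrho N0); field; rewrite gt_eqF.
  by ring.
Unshelve. all: by end_near. Qed.

End return_map_limit.

Theorem theorem3p1 (R : realType) (L T alpha : R) (A : R -> 'M[R]_2)
    (L_gt0 : 0 < L) (T_gt0 : 0 < T)
    (A_sl2 : forall t, sl2 (A t))
    (A_meas : mx_measurable A)
    (A_bounded : bounded_fun A)
    (A_periodic : periodic A L)
    (A_mean0 : mx_int 0 L A = 0) :
  (forall Z : nat -> R -> 'M[R]_2,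
     (forall N, (0 < N)%N ->
        fundamental_solution T (C_rho alpha A (rho L T N)) (Z N)) ->
     (alpha < 2^-1 -> Z N T @[N --> \oo] --> (1%:M : 'M[R]_2)) /\
     (alpha = 2^-1 ->
        Z N T @[N --> \oo] --> mx_exp ((T / L) *: Omega2 L A))) /\
  (sl2 (Omega2 L A) /\
   (hyperbolic (mx_exp ((T / L) *: Omega2 L A)) <-> \det (Omega2 L A) < 0)).
Proof.
have [a Aa] : exists a, forall t, `|A t| <= a.
  have [M [_ AM]] := A_bounded.
  by exists (M + 1) => t; apply: AM => //; rewrite ltrDl.
have trO : sl2 (Omega2 L A) := Omega2_sl2 (ltW L_gt0) A_meas Aa.
split; last first.
  split => //; rewrite mx_exp_hyperbolic; last by rewrite mxtraceZ trO mulr0.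
  rewrite detZ.
  by rewrite pmulr_rlt0// exprn_gt0// divr_gt0.
(* Writing [alpha] as [1 - (1 - alpha)] matches the parameter [p = 1 - alpha]; the conditions on
   [alpha] become [p > 1/2] and [p = 1/2]. *)
move=> Z; rewrite -{1}(subKr 1 alpha) => HZ; split=> [a12|a12].
  by apply: (return_map_cvg1 L_gt0 T_gt0 A_meas Aa A_periodic A_mean0 HZ); lra.
by apply: (return_map_cvg_exp L_gt0 T_gt0 A_meas Aa A_periodic A_mean0 HZ); lra.
Qed.
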